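(* Every orthogonal, left-finite TRS is infinitarily confluent w.r.t. strong $p$-convergence: if $t$ strongly $p$-converges to $s_1$ and $t$ strongly $p$-converges to $s_2$, then there is $t'$ such that $s_1$ strongly $p$-converges to $t'$ and $s_2$ strongly $p$-converges to $t'$.
   Context: Orthogonal = left-linear and non-overlapping; left-finite = all left-hand sides finite. Terms are partial terms over $\Sigma_\bot=\Sigma\uplus\{\bot\}$, ordered by $\le_\bot$ ($s\le_\bot t$ iff $s$ is $t$ with some subterms replaced by $\bot$), a complete semilattice; $\liminf_{\iota\to\alpha}a_\iota=\bigvee_{\beta<\alpha}\bigwedge_{\beta\le\iota<\alpha}a_\iota$. A transfinite reduction $(t_\iota\to_{\pi_\iota}t_{\iota+1})_{\iota<\alpha}$ with contexts $c_\iota$ ($t_\iota$ with position $\pi_\iota$ replaced by $\bot$) strongly $p$-converges to $t$ if $\liminf_{\iota\to\lambda}c_\iota=t_\lambda$ for every limit $\lambda<\alpha$, and $t$ is the last term if the reduction is closed, resp. $t=\liminf_{\iota\to\alpha}c_\iota$ if it is open; the empty reduction converges from $t$ to $t$. *)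

(* Defs.v *)
From mathcomp Require Import all_boot.
Set Implicit Arguments. Unset Strict Implicit. Unset Printing Implicit Defensive.

(** Partial (possibly infinite) terms over Sigma_bot = Sigma + {bot} with
    variables V, represented as labelled tree domains:
    a term maps each position (list of argument indices) to its label,
    or None if the position is not in the term. *)

Inductive lab (F V : Type) : Type :=
| LFun of F
| LVar of V
| LBot.
Arguments LBot {F V}.
Arguments LVar {F V}.
Arguments LFun {F V}.

Definition position := seq nat.
Definition pterm (F V : Type) := position -> option (lab F V).

Definition arity (F V : Type) (ar : F -> nat) (l : lab F V) : nat :=
  match l with LFun f => ar f | _ => 0 end.

Definition wf_term (F V : Type) (ar : F -> nat) (t : pterm F V) : Prop :=
  t [::] <> None /\
  (forall p i, t p = None -> t (rcons p i) = None) /\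
  (forall p l i, t p = Some l -> (t (rcons p i) <> None <-> i < arity ar l)).

Definition total (F V : Type) (t : pterm F V) : Prop :=
  forall p, t p <> Some LBot.

Definition teq (F V : Type) (s t : pterm F V) : Prop := forall p, s p = t p.

(** s <=_bot t : s is t with some subterms replaced by bot *)
Definition leq_bot (F V : Type) (s t : pterm F V) : Prop :=
  forall p, s p <> None -> t p <> None /\ (s p = Some LBot \/ s p = t p).

Definition subterm (F V : Type) (t : pterm F V) (pi : position) : pterm F V :=
  fun p => t (pi ++ p).

Definition replace (F V : Type) (t : pterm F V) (pi : position) (s : pterm F V)
  : pterm F V :=
  fun p => if prefix pi p then s (drop (size pi) p) else t p.

Definition bot_term (F V : Type) : pterm F V :=
  fun p => match p with [::] => Some LBot | _ => None end.

Definition context (F V : Type) (t : pterm F V) (pi : position) : pterm F V :=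
  replace t pi (@bot_term F V).

Fixpoint subst_aux (F V : Type) (l : pterm F V) (sigma : V -> pterm F V)
  (q p : position) : option (lab F V) :=
  match l q with
  | Some (LVar x) => sigma x p
  | _ => match p with
         | [::] => l q
         | i :: p' => subst_aux l sigma (rcons q i) p'
         end
  end.

Definition subst (F V : Type) (l : pterm F V) (sigma : V -> pterm F V)
  : pterm F V := fun p => subst_aux l sigma [::] p.

Definition is_trs (F V R : Type) (ar : F -> nat) (lhs rhs : R -> pterm F V)
  : Prop :=
  forall rho,
    wf_term ar (lhs rho) /\ wf_term ar (rhs rho) /\
    total (lhs rho) /\ total (rhs rho) /\
    (forall x : V, lhs rho [::] <> Some (LVar x)) /\
    (forall p (x : V), rhs rho p = Some (LVar x) -> exists q, lhs rho q = Some (LVar x)).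

Definition left_linear (F V R : Type) (lhs : R -> pterm F V) : Prop :=
  forall rho p q x, lhs rho p = Some (LVar x) -> lhs rho q = Some (LVar x) ->
    p = q.

Definition unifiable (F V : Type) (ar : F -> nat) (s t : pterm F V) : Prop :=
  exists sigma1 sigma2 : V -> pterm F V,
    (forall x, wf_term ar (sigma1 x) /\ total (sigma1 x)) /\
    (forall x, wf_term ar (sigma2 x) /\ total (sigma2 x)) /\
    teq (subst s sigma1) (subst t sigma2).

(** no lhs unifies (with variables renamed apart) with a non-variable subterm
    of a lhs, except trivially a lhs with itself at the root *)
Definition non_overlapping (F V R : Type) (ar : F -> nat) (lhs : R -> pterm F V)
  : Prop :=
  forall rho1 rho2 pi f,
    lhs rho1 pi = Some (LFun f) ->
    unifiable ar (subterm (lhs rho1) pi) (lhs rho2) ->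
    rho1 = rho2 /\ pi = [::].

Definition orthogonal (F V R : Type) (ar : F -> nat) (lhs : R -> pterm F V)
  : Prop := left_linear lhs /\ non_overlapping ar lhs.

Definition left_finite (F V R : Type) (lhs : R -> pterm F V) : Prop :=
  forall rho, exists L : seq position, forall p, lhs rho p <> None -> p \in L.

Definition step (F V R : Type) (ar : F -> nat) (lhs rhs : R -> pterm F V)
  (t : pterm F V) (pi : position) (t' : pterm F V) : Prop :=
  wf_term ar t /\ t pi <> None /\
  exists (rho : R) (sigma : V -> pterm F V),
    (forall x, wf_term ar (sigma x)) /\
    teq (subterm t pi) (subst (lhs rho) sigma) /\
    teq t' (replace t pi (subst (rhs rho) sigma)).

Definition is_glb (F V : Type) (ar : F -> nat) (P : pterm F V -> Prop)
  (m : pterm F V) : Prop :=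
  wf_term ar m /\ (forall a, P a -> leq_bot m a) /\
  (forall b, wf_term ar b -> (forall a, P a -> leq_bot b a) -> leq_bot b m).

Definition is_lub (F V : Type) (ar : F -> nat) (P : pterm F V -> Prop)
  (m : pterm F V) : Prop :=
  wf_term ar m /\ (forall a, P a -> leq_bot a m) /\
  (forall b, wf_term ar b -> (forall a, P a -> leq_bot a b) -> leq_bot m b).

(** Ordinals are represented by well-ordered index types. *)
Definition is_wellorder (I : Type) (lt : I -> I -> Prop) : Prop :=
  (forall i, ~ lt i i) /\
  (forall i j k, lt i j -> lt j k -> lt i k) /\
  (forall i j, lt i j \/ i = j \/ lt j i) /\
  well_founded lt.

Definition is_succ (I : Type) (lt : I -> I -> Prop) (i j : I) : Prop :=
  lt i j /\ (forall k, lt i k -> lt k j -> False).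

(** t = liminf_{iota -> lambda} c_iota
       = lub_{beta < lambda} glb_{beta <= iota < lambda} c_iota,
    where "below" describes the indices iota < lambda *)
Definition is_liminf (F V : Type) (ar : F -> nat) (I : Type)
  (lt : I -> I -> Prop) (below : I -> Prop) (c : I -> pterm F V)
  (t : pterm F V) : Prop :=
  exists m : I -> pterm F V,
    (forall b, below b ->
       is_glb ar (fun a => exists i, below i /\ (b = i \/ lt b i) /\ a = c i)
              (m b)) /\
    is_lub ar (fun a => exists b, below b /\ a = m b) t.

(** t strongly p-converges to s: there is a transfinite reduction
    (t_iota ->_{pi_iota} t_{iota+1})_{iota < alpha}, with alpha the order type
    of (I, lt), tm iota = t_iota, tgt iota = t_{iota+1}, ps iota = pi_iota. *)
Definition spconv (F V R : Type) (ar : F -> nat) (lhs rhs : R -> pterm F V)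
  (t s : pterm F V) : Prop :=
  wf_term ar t /\ wf_term ar s /\
  exists (I : Type) (lt : I -> I -> Prop) (tm tgt : I -> pterm F V)
         (ps : I -> position),
    is_wellorder lt /\
    (forall i, step ar lhs rhs (tm i) (ps i) (tgt i)) /\
    (forall i, wf_term ar (tgt i)) /\
    (forall i, (forall j, ~ lt j i) -> teq (tm i) t) /\
    (forall i j, is_succ lt i j -> teq (tm j) (tgt i)) /\
    (forall l, (exists j, lt j l) -> (forall i, ~ is_succ lt i l) ->
       is_liminf ar lt (fun i => lt i l) (fun i => context (tm i) (ps i)) (tm l)) /\
    ((I -> False) -> teq t s) /\
    (forall m, (forall j, ~ lt m j) -> teq (tgt m) s) /\
    ((exists i : I, True) -> (forall m, exists j, lt m j) ->
       is_liminf ar lt (fun _ => True) (fun i => context (tm i) (ps i)) s).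

(* Main.v *)
(** Call [t ->> s] ([inf t s]) the coinductive relation: either finitely many steps from [t]
    produce the root symbol of [s], and the arguments are again related by [->>], or [s] is [LBot]
    and [t] is root-active, i.e. admits infinitely many root contractions. For finite left-hand
    sides this is strong p-convergence. From left to right one uses transfinite induction along the
    reduction (if [t ->> s] and [s] is a redex, then [t] finitely reduces to a redex of the same
    rule); from right to left all arguments are reduced in a fair order, which gives a reduction
    of length at most omega.

    The relation [->>] is transitive. Contractions of sets of disjoint redexes have the diamond
    property, which implies that root-active terms are closed under reduction. Hence a term either
    is root-active or reduces to a root-stable term, but not both, and root-stability, the root
    symbol, and the arguments up to conversion do not depend on the chosen root-stable reduct. So
    every term has a normal form [nf t], obtained by repeatedly choosing root-stable reducts and
    putting [LBot] where there is none, and [t ->> s] implies [s ->> nf t]. *)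
Require Import Defs.
From mathcomp Require Import all_boot.
From Stdlib Require Import Classical ClassicalEpsilon FunctionalExtensionality.
Set Implicit Arguments. Unset Strict Implicit. Unset Printing Implicit Defensive.

(** The hard point is to reflect root-stability: if the arguments of [v] are related by [->>] to
    those of a root-stable [y] with the same root symbol, then [v] is root-stable. A finite
    reduction from [v] to a redex would have to be projected over infinite reductions, which is an
    instance of the confluence to be proved. However, only a finite left-hand side has to be carried
    over to [y], so an induction on the number of steps is enough ([reach_skel]). Infinite
    right-hand sides shape the diagrams: projecting a single step may require infinitely many
    contractions, so diagrams are closed with [par] or [inf] rather than with finite reductions.
    Non-overlap enters in two forms: the contractum of a redex is unique, and an instance of a
    proper non-variable subpattern of a left-hand side is never a redex and stays an instance under
    reduction. *)

Lemma choice (A B : Type) (P : A -> B -> Prop) :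
  (forall a, exists b, P a b) -> exists f, forall a, P a (f a).
Proof.
move=> h; exists (fun a => proj1_sig (constructive_indefinite_description _ (h a))).
by move=> a; case: constructive_indefinite_description.
Qed.

(** * Terms as a final coalgebra *)

Section Terms.
Variables (F V : Type) (ar : F -> nat).
Notation arty := (arity ar).

Record term := Term { tf : pterm F V; tf_wf : wf_term ar tf }.

Lemma term_ext s t : tf s =1 tf t -> s = t.
Proof.
case: s t => [s ws] [t wt] /= e; have := functional_extensionality _ _ e => est.
by move: ws; rewrite est => ws; rewrite (proof_irrelevance _ ws wt).
Qed.

Definition root (t : term) : lab F V :=
  if tf t [::] is Some l then l else LBot.

Lemma tf_nil t : tf t [::] = Some (root t).
Proof. by rewrite /root; case: t => t [/= wt _]; case: (t [::]) wt. Qed.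

Lemma wf_bot : wf_term ar (@bot_term F V).
Proof. by split=> //; split=> [[|j p] i|[|j p] l i] //= [<-]; split. Qed.

Definition botT := Term wf_bot.

Definition node_fun (l : lab F V) (ts : nat -> term) : pterm F V := fun p =>
  match p with
  | [::] => Some l
  | i :: q => if i < arty l then tf (ts i) q else None
  end.

Lemma wf_node l ts : wf_term ar (node_fun l ts).
Proof.
split=> //; split=> [[|j p] i|[|j p] l' i] //=.
- by case: ifP => // _; case: (tf_wf (ts j)) => _ [h _]; apply: h.
- by move=> [<-]; case: ifP => // h; split=> // _; rewrite tf_nil.
- by case: ifP => // _; case: (tf_wf (ts j)) => _ [_ h]; apply: h.
Qed.

Definition node l ts := Term (wf_node l ts).

(** Outside the arity the value is a dummy, which makes [child] total; hence the guards
    [i < arty (root t)] below. *)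
Definition child_fun (t : term) (i : nat) : pterm F V :=
  if i < arty (root t) then fun p => tf t (i :: p) else @bot_term F V.

Lemma wf_child t i : wf_term ar (child_fun t i).
Proof.
rewrite /child_fun; case: ifP => hi; last exact: wf_bot.
case: (tf_wf t) => h1 [h2 h3]; split; first by apply/(h3 [::] (root t) i (tf_nil t)).
by split=> [p j|p l j]; [apply: (h2 (i :: p))|apply: (h3 (i :: p))].
Qed.

Definition child t i := Term (wf_child t i).

Lemma tf_None_cat t p q : tf t p = None -> tf t (p ++ q) = None.
Proof.
elim/last_ind: q => [|q i IH]; first by rewrite cats0.
by move=> /IH h; rewrite -rcons_cat; case: (tf_wf t) => _ [h2 _]; apply: h2.
Qed.

Lemma tf_cons t i p :
  tf t (i :: p) = if i < arty (root t) then tf (child t i) p else None.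
Proof.
rewrite /= /child_fun; case hi: (i < arty (root t)) => //.
case: (tf_wf t) => _ [_ /(_ [::] _ i (tf_nil t)) /= h3].
rewrite -cat1s tf_None_cat //; by apply: NNPP => h; move: (proj1 h3 h); rewrite hi.
Qed.

Lemma root_node l ts : root (node l ts) = l.
Proof. by []. Qed.

Lemma child_node l ts i : i < arty l -> child (node l ts) i = ts i.
Proof. by move=> hi; apply: term_ext => p; rewrite /= /child_fun root_node hi /= hi. Qed.

(** A position is reached by finitely many [child] steps, so induction on positions yields equality
    of all labels, which [term_ext] turns into Leibniz equality. *)
Lemma bisim (X : term -> term -> Prop) :
  (forall s t, X s t -> root s = root t /\
     forall i, i < arty (root s) -> X (child s i) (child t i)) ->
  forall s t, X s t -> s = t.
Proof.
move=> h s t hX; apply: term_ext => p.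
elim: p s t hX => [|i p IH] s t /h [e hc]; first by rewrite !tf_nil e.
by rewrite !tf_cons -e; case: ifP => // /hc /IH.
Qed.

Lemma term_eq s t : root s = root t ->
  (forall i, i < arty (root s) -> child s i = child t i) -> s = t.
Proof.
move=> e h; apply: (@bisim (fun a b => a = b \/ (root a = root b /\
  forall i, i < arty (root a) -> child a i = child b i))); last by right.
by move=> a b [->|[e1 h1]]; split=> // i hi; left; rewrite ?h1.
Qed.

Lemma root_bot t : root t = LBot -> t = botT.
Proof. by move=> e; apply: term_eq => //; rewrite e. Qed.

(** The anamorphism of the state machine [f]. Recursion runs on the position, so infinite terms
    arise without coinductive types. *)
Fixpoint unfold_fun (A : Type) (f : A -> lab F V * (nat -> A)) (a : A)
    (p : position) : option (lab F V) :=
  match p with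
  | [::] => Some (f a).1
  | i :: q => if i < arty (f a).1 then unfold_fun f ((f a).2 i) q else None
  end.

Lemma wf_unfold A f a : wf_term ar (@unfold_fun A f a).
Proof.
split=> //; split=> p; elim: p a => [|j p IH] a //=.
- by move=> i; case: ifP => // _; apply: IH.
- by move=> l i [<-]; case: ifP => // h; split.
- by move=> l i; case: ifP => // _; apply: IH.
Qed.

Definition unfold A f a := Term (@wf_unfold A f a).

Lemma root_unfold A f a : root (@unfold A f a) = (f a).1.
Proof. by []. Qed.

Lemma child_unfold A f a i : i < arty (f a).1 ->
  child (@unfold A f a) i = unfold f ((f a).2 i).
Proof. by move=> h; apply: term_ext => p; rewrite /= /child_fun root_unfold h /= h. Qed.

Definition upd (t : term) (i : nat) (s : term) : term :=
  node (root t) (fun j => if j == i then s else child t j).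

Lemma root_upd t i s : root (upd t i s) = root t.
Proof. by []. Qed.

Lemma child_upd t i s j : j < arty (root t) ->
  child (upd t i s) j = if j == i then s else child t j.
Proof. by move=> h; rewrite child_node. Qed.

(** In state [inl p] the construction is still inside the pattern; in state [inr t] it copies a
    substituted term. *)
Definition sub_step (sg : V -> term) (a : term + term) :
    lab F V * (nat -> term + term) :=
  match a with
  | inl p => if root p is LVar x then (root (sg x), fun i => inr (child (sg x) i))
             else (root p, fun i => inl (child p i))
  | inr t => (root t, fun i => inr (child t i))
  end.

Definition sub p sg := unfold (sub_step sg) (inl p).

Lemma unfold_inr sg t : unfold (sub_step sg) (inr t) = t.
Proof.
apply: (@bisim (fun a b => a = unfold (sub_step sg) (inr b))) => // a b -> {a}.
by split=> // i hi; rewrite child_unfold.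
Qed.

Lemma sub_var p sg x : root p = LVar x -> sub p sg = sg x.
Proof.
move=> e; apply: term_eq; first by rewrite root_unfold /= e.
by rewrite root_unfold /= e => i hi; rewrite child_unfold /= e ?unfold_inr.
Qed.

Lemma root_sub p sg : (forall x, root p <> LVar x) -> root (sub p sg) = root p.
Proof. by rewrite root_unfold /=; case: (root p) => // x /(_ x). Qed.

Lemma child_sub p sg i : (forall x, root p <> LVar x) -> i < arty (root p) ->
  child (sub p sg) i = sub (child p i) sg.
Proof.
move=> h hi; rewrite child_unfold /=; by case: (root p) h hi => // x /(_ x).
Qed.

Lemma subst_aux_shift (l : pterm F V) sg q r p :
  subst_aux (subterm l q) sg r p = subst_aux l sg (q ++ r) p.
Proof.
by elim: p r => [|i p IH] r /=; rewrite /subterm ?IH ?rcons_cat.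
Qed.

Lemma tf_sub p sg q : tf (sub p sg) q = subst (tf p) (fun x => tf (sg x)) q.
Proof.
elim: q p => [|i q IH] p.
  rewrite tf_nil /subst /= tf_nil; case e: (root p) => [f|x|]; last first.
  - by rewrite root_sub e.
  - by rewrite (sub_var _ e) tf_nil.
  - by rewrite root_sub e.
case: (classic (exists x, root p = LVar x)) => [[x e]|nv].
  by rewrite (sub_var _ e) /subst /= tf_nil e.
have {}nv x : root p <> LVar x by move=> e; case: nv; exists x.
have -> : subst (tf p) (fun x => tf (sg x)) (i :: q) =
          subst_aux (tf p) (fun x => tf (sg x)) [:: i] q.
  by rewrite /subst /= tf_nil; case: (root p) nv => // x /(_ x).
rewrite tf_cons root_sub //; case: ifP => hi.
  rewrite child_sub // IH /subst -[[:: i]]cats0 -subst_aux_shift.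
  congr subst_aux; apply: functional_extensionality => r.
  by rewrite /subterm /= /child_fun hi.
have no r : tf p (i :: r) = None by rewrite tf_cons hi.
by elim: q [::] {IH} => [|j q IH] r /=; rewrite ?no.
Qed.

Definition occurs x (p : term) := exists q, tf p q = Some (LVar x).

Lemma occurs_child x p i : i < arty (root p) -> occurs x (child p i) -> occurs x p.
Proof. by move=> hi [q hq]; exists (i :: q); rewrite tf_cons hi. Qed.

Lemma occurs_root x p : root p = LVar x -> occurs x p.
Proof. by move=> e; exists [::]; rewrite tf_nil e. Qed.

Definition isvar (p : term) := exists x, root p = LVar x.

Lemma not_isvar p : ~ isvar p -> forall x, root p <> LVar x.
Proof. by move=> h x e; apply: h; exists x. Qed.

Lemma sub_ext p sg sg' : (forall x, occurs x p -> sg x = sg' x) -> sub p sg = sub p sg'.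
Proof.
move=> h; apply: (@bisim (fun a b => a = b \/ exists p,
  [/\ a = sub p sg, b = sub p sg' & forall x, occurs x p -> sg x = sg' x]));
  last by right; exists p.
move=> a b [->|[{h}p [-> -> h]]]; first by split=> // i hi; left.
case: (classic (isvar p)) => [[x e]|/not_isvar nv].
  rewrite !(sub_var _ e) (h x) //; last exact: occurs_root.
  by split=> // i hi; left.
rewrite !root_sub //; split=> // i hi; right; exists (child p i).
by rewrite !child_sub //; split=> // x /(occurs_child hi) /h.
Qed.

Lemma sub_inj p sg sg' x : sub p sg = sub p sg' -> occurs x p -> sg x = sg' x.
Proof.
move=> e [q]; elim: q p e => [|i q IH] p e.
  by rewrite tf_nil => -[e1]; rewrite !(sub_var _ e1) in e.
rewrite tf_cons; case: ifP => // hi; apply: IH.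
have nv y : root p <> LVar y by move=> e1; rewrite e1 in hi.
by rewrite -!child_sub // e.
Qed.

Definition linear (p : term) := forall q q' x,
  tf p q = Some (LVar x) -> tf p q' = Some (LVar x) -> q = q'.

Lemma linear_child p i : i < arty (root p) -> linear p -> linear (child p i).
Proof.
move=> hi h q q' x e e'; have := h (i :: q) (i :: q') x.
by rewrite !tf_cons hi => /(_ e e') [].
Qed.

(** [pat X p b]: [b] matches the finite pattern [p], and [X x c] holds for the subterm [c] of [b]
    at each occurrence of [x] in [p]. *)
Inductive pat (X : V -> term -> Prop) : term -> term -> Prop :=
| pat_var p x b : root p = LVar x -> X x b -> pat X p b
| pat_fun p f b : root p = LFun f -> root b = LFun f ->
    (forall i, i < ar f -> pat X (child p i) (child b i)) -> pat X p b.

Lemma pat_mono (X Y : V -> term -> Prop) p b : (forall x c, X x c -> Y x c) ->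
  pat X p b -> pat Y p b.
Proof.
move=> h; elim=> {p b} [p x b e /h|p f b e e' _ IH]; first exact: pat_var.
exact: pat_fun e e' IH.
Qed.

Inductive fin (p : term) : Prop :=
  Fin of (forall i, i < arty (root p) -> fin (child p i)).

Definition tot (p : term) := forall q, tf p q <> Some LBot.

Lemma tot_child p i : i < arty (root p) -> tot p -> tot (child p i).
Proof. by move=> hi h q e; apply: (h (i :: q)); rewrite tf_cons hi. Qed.

(** Finiteness is needed because [pat] is inductive, totality because no constructor of [pat]
    accepts [LBot]. *)
Lemma pat_sub p sg : fin p -> tot p -> pat (fun x b => b = sg x) p (sub p sg).
Proof.
elim=> {}p _ IH tp; case e: (root p) => [f|x|].
- have nv x : root p <> LVar x by rewrite e.
  apply: (pat_fun e); first by rewrite root_sub.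
  move=> i hi; have hi' : i < arty (root p) by rewrite e.
  by rewrite child_sub //; apply: IH => //; apply: tot_child.
- by apply: (pat_var e); rewrite (sub_var _ e).
- by case: (tp [::]); rewrite tf_nil e.
Qed.

(** By linearity a variable occurs in at most one argument, so the substitutions found for the
    arguments can be glued; [inh] supplies values for variables that do not occur. *)
Lemma pat_inst X p b : linear p -> (forall x, exists c, X x c) -> pat X p b ->
  exists sg, b = sub p sg /\ forall x, X x (sg x).
Proof.
move=> + inh hp; have [d hd] := choice inh.
elim: hp => {p b} [p x b e hx|p f b e e' _ IH] lp.
  exists (fun y => if excluded_middle_informative (y = x) then b else d y).
  rewrite (sub_var _ e); split; first by case: excluded_middle_informative.
  by move=> y; case: excluded_middle_informative => [eyx|] /=; rewrite ?eyx.
have nv x : root p <> LVar x by rewrite e.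
have /choice [sgs hs] : forall i, exists sg, i < ar f ->
    child b i = sub (child p i) sg /\ forall x, X x (sg x).
  move=> i; case hi: (i < ar f); last by exists d.
  case: (IH i hi) => [|sg hsg]; last by exists sg.
  by apply: linear_child => //; rewrite e.
have /choice [sg hsg] : forall x, exists c,
    X x c /\ forall i, i < ar f -> occurs x (child p i) -> c = sgs i x.
  move=> x; case: (classic (exists2 i, i < ar f & occurs x (child p i))).
    move=> [i hi [q hq]]; exists (sgs i x); split; first by case: (hs i hi).
    move=> j hj [q' hq']; have := lp (i :: q) (j :: q') x.
    by rewrite !tf_cons e /= hi hj => /(_ hq hq') [->].
  move=> no; exists (d x); split=> // i hi ho; by case: no; exists i.
exists sg; split=> [|x]; last by case: (hsg x).
apply: term_eq; first by rewrite root_sub // e e'.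
rewrite e' => i hi; rewrite child_sub ?e //; case: (hs i hi) => -> _.
by apply: sub_ext => x ho; case: (hsg x) => _ /(_ i hi ho).
Qed.

End Terms.

(** * Positions, contexts and limits inferior *)

Section Positions.
Variables (F V : Type) (ar : F -> nat).
Notation term := (term V ar).
Notation arty := (arity ar).

Definition valid (t : term) p := tf t p <> None.

Lemma valid_nil (t : term) : valid t [::].
Proof. by rewrite /valid tf_nil. Qed.

Lemma valid_cons (t : term) i p :
  valid t (i :: p) <-> i < arty (root t) /\ valid (child t i) p.
Proof. by rewrite /valid tf_cons; case: ifP => h; split=> // -[]. Qed.

Fixpoint at_pos (t : term) (p : position) : term :=
  if p is i :: q then at_pos (child t i) q else t.

Lemma at_cat (t : term) p q : at_pos t (p ++ q) = at_pos (at_pos t p) q.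
Proof. by elim: p t => /=. Qed.

Lemma tf_at (t : term) p q : valid t p -> tf (at_pos t p) q = tf t (p ++ q).
Proof.
elim: p t => // i p IH t /valid_cons [hi hp].
by rewrite cat_cons tf_cons hi; apply: IH.
Qed.

Lemma tf_root (t : term) p : valid t p -> tf t p = Some (root (at_pos t p)).
Proof. by move=> h; rewrite -tf_nil tf_at // cats0. Qed.

Lemma valid_label (t : term) p l : tf t p = Some l -> valid t p /\ root (at_pos t p) = l.
Proof.
by move=> e; have v : valid t p by [rewrite /valid e]; split=> //; move: e;
  rewrite tf_root // => -[].
Qed.

Lemma valid_rcons (t : term) p i :
  valid t (rcons p i) <-> valid t p /\ i < arty (root (at_pos t p)).
Proof.
elim: p t => [|j p IH] t /=; first by rewrite valid_cons; split=> -[? ?]; split=> //; apply: valid_nil.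
by rewrite !valid_cons IH; tauto.
Qed.

Fixpoint replace_at (t : term) (p : position) (s : term) : term :=
  if p is i :: q then upd t i (replace_at (child t i) q s) else s.

Lemma tf_replace_at (t : term) p s q : valid t p ->
  tf (replace_at t p s) q = replace (tf t) p (tf s) q.
Proof.
rewrite /replace; elim: p t q => [|i p IH] t q; first by rewrite prefix0s drop0.
move=> /valid_cons [hi hp]; case: q => [|j q]; first by rewrite tf_nil [RHS]tf_nil.
rewrite [replace_at _ _ _]/= tf_cons root_upd prefix_cons [RHS]/=.
case hj: (j < arty (root t)); last first.
  have -> : (i == j) = false by apply: contraFF hj => /eqP <-.
  by rewrite [RHS]tf_cons hj.
rewrite child_upd // eq_sym; case: eqP => [e|_] /=; last by rewrite /child_fun hj.
by subst j; rewrite IH //= /child_fun hi.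
Qed.

Definition ctx (t : term) p := replace_at t p (botT V ar).

Lemma tf_ctx (t : term) p q : valid t p -> tf (ctx t p) q = context (tf t) p q.
Proof. exact: tf_replace_at. Qed.

Lemma ctx_off (t : term) p q : ~~ prefix p q -> valid t p -> tf (ctx t p) q = tf t q.
Proof. by move=> /negPf h v; rewrite tf_ctx // /context /replace h. Qed.

Lemma ctx_on (t : term) p q : prefix p q -> valid t p ->
  tf (ctx t p) q = if p == q then Some LBot else None.
Proof.
move=> /prefixP [r ->] v; rewrite tf_ctx // /context /replace prefix_prefix drop_size_cat //.
case: r => [|i r] /=; first by rewrite cats0 eqxx.
by case: eqP => // /(congr1 size); rewrite size_cat /= => /eqP; rewrite -{1}[size p]addn0 eqn_add2l.
Qed.

Lemma leq_bot_node (a b : term) : (root a = LBot \/ (root a = root b /\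
    forall i, i < arty (root a) -> leq_bot (tf (child a i)) (tf (child b i)))) ->
  leq_bot (tf a) (tf b).
Proof.
case=> [e|[e h]] [|i p].
- by rewrite !tf_nil e; split=> //; left.
- by rewrite tf_cons e.
- by rewrite !tf_nil e; split=> //; right.
- by rewrite !tf_cons -e; case: ifP => // /h hle; apply: hle.
Qed.

(** Below every term that agrees with [t] on the prefixes of [p]; this makes it a test term for
    infima of tails. *)
Fixpoint path_term (t : term) (p : position) : term :=
  if p is i :: q
  then node (root t) (fun j => if j == i then path_term (child t i) q else botT V ar)
  else node (root t) (fun _ => botT V ar).

Lemma leq_bot_bot (t : term) : leq_bot (tf (botT V ar)) (tf t).
Proof. by apply: leq_bot_node; left. Qed.

Lemma path_term_at (t : term) p : valid t p -> tf (path_term t p) p = tf t p.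
Proof.
elim: p t => [|i p IH] t; first by rewrite !tf_nil.
move=> /valid_cons [hi hp]; rewrite !tf_cons [path_term _ _]/= root_node hi.
by rewrite child_node // eqxx IH.
Qed.

Lemma path_term_leq (t s : term) p : valid t p ->
  (forall q, prefix q p -> tf s q = tf t q) -> leq_bot (tf (path_term t p)) (tf s).
Proof.
elim: p t s => [|i p IH] t s hp h.
  apply: leq_bot_node; right; split=> [|j hj].
    by have := h [::] isT; rewrite !tf_nil => -[].
  by rewrite child_node //; apply: leq_bot_bot.
have e : root s = root t by have := h [::] isT; rewrite !tf_nil => -[].
move/valid_cons: hp => [hi hp].
apply: leq_bot_node; right; split=> // j hj; rewrite [path_term _ _]/= child_node //.
case: eqP => [->|_]; last exact: leq_bot_bot.
apply: IH => // q hq; have := h (i :: q).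
by rewrite prefix_cons eqxx !tf_cons e hi; apply.
Qed.

Section Liminf.
Variables (I : Type) (lt : I -> I -> Prop) (B : I -> Prop) (c : I -> pterm F V) (t : term).
Hypothesis lim : is_liminf ar lt B c (tf t).

(** If no tail infimum had label [l] at [p], then [t] cut off at [p] would still bound all of them,
    against the leastness of [t]. An infimum with label [l] forces [l] on its whole tail. *)
Lemma liminf_label p l : tf t p = Some l -> l <> LBot ->
  exists2 b, B b & forall i, B i -> b = i \/ lt b i -> c i p = Some l.
Proof.
move=> et nl; case: lim => m [hm [_ [ub lub]]].
have vp : valid t p by rewrite /valid et.
have [b [Bb hb]] : exists b, B b /\ m b p = Some l.
  apply: NNPP => no.
  have : leq_bot (tf t) (tf (ctx t p)).
    apply: lub => [|_ [b [Bb ->]]]; first exact: tf_wf.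
    have [wm _] := hm b Bb; have hle := ub _ (ex_intro _ b (conj Bb erefl)).
    move=> q hq; have [h1 h2] := hle q hq.
    case pq: (prefix p q); last by rewrite ctx_off ?pq.
    rewrite ctx_on //; case: eqP => [e|ne].
      split=> //; left; case: h2 => // h2; case: no; exists b.
      by rewrite e h2 -e.
    case: no; exists b; split=> //.
    pose mb := Term wm; have vb : valid mb p.
      by move=> /tf_None_cat h; case/prefixP: pq hq => r -> /(_ (h _)).
    have [_ h4] := hle p vb; rewrite -et; case: h4 => // e4.
    case/prefixP: pq hq => [[|i r] e5]; first by rewrite e5 cats0 in ne.
    rewrite e5 -cat_rcons => h5.
    have /valid_rcons[_] : valid mb (rcons p i) by move=> h6; apply/h5/(@tf_None_cat _ _ _ mb).
    by have [_ ->] := @valid_label mb p _ e4.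
  move=> /(_ p vp) []; rewrite ctx_on ?prefix_refl // eqxx et.
  by move=> _ [] [].
exists b => // i Bi hbi; have [_ [h1 _]] := hm b Bb.
have /h1 /(_ p) : exists i0, B i0 /\ (b = i0 \/ lt b i0) /\ c i = c i0 by exists i.
by rewrite hb => -[] // _ [] // -[].
Qed.

(** [path_term u p] lies below all contexts from [b] on, hence below their infimum and below [t].
    Where [u] has [LBot], this only gives validity of [p] in [t]. *)
Lemma liminf_path (u : term) p b : B b -> valid u p ->
  (forall i, B i -> b = i \/ lt b i -> exists2 ci : term, c i = tf ci &
     forall q, prefix q p -> tf ci q = tf u q) ->
  valid t p /\ (tf u p = Some LBot \/ tf t p = tf u p).
Proof.
move=> Bb vp h; case: lim => m [hm [_ [ub _]]].
have [_ [_ glb]] := hm b Bb.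
have le1 : leq_bot (tf (path_term u p)) (m b).
  apply: glb => [|_ [i [Bi [hbi ->]]]]; first exact: tf_wf.
  by have [ci -> hc] := h i Bi hbi; apply: path_term_leq.
have le2 := ub _ (ex_intro _ b (conj Bb erefl)).
have e := path_term_at vp.
have [] := le1 p; rewrite e //.
move=> nb; have [v h2] := le2 p nb; case=> [e1|e1]; first by split=> //; left.
split=> //; case: h2 => e2; [left|right]; congruence.
Qed.

End Liminf.
(** Infimum of a non-empty set by corecursion on sets: a root shared by all members is kept,
    otherwise [LBot] is put, and the next states are the sets of children. *)
Definition glb_step (A : term -> Prop) : lab F V * (nat -> term -> Prop) :=
  (match excluded_middle_informative (exists l, forall a, A a -> root a = l) with
   | left h => proj1_sig (constructive_indefinite_description _ h)
   | right _ => LBot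
   end, fun i b => exists2 a, A a & b = child a i).

Definition glb A := unfold ar glb_step A.

Lemma root_glb A a l : A a -> (forall a, A a -> root a = l) -> root (glb A) = l.
Proof.
move=> Aa h; rewrite root_unfold /=; case: excluded_middle_informative => [h1|[]].
  by case: constructive_indefinite_description => l' /= /(_ a Aa) <-; apply: h.
by exists l.
Qed.

Lemma root_glb_cases A : root (glb A) = LBot \/ forall a, A a -> root a = root (glb A).
Proof.
rewrite root_unfold /=; case: excluded_middle_informative => [h1|_]; last by left.
by right; case: constructive_indefinite_description.
Qed.

Lemma child_glb A i : i < arty (root (glb A)) ->
  child (glb A) i = glb (fun b => exists2 a, A a & b = child a i).
Proof. exact: child_unfold. Qed.

Lemma glb_lower A a : A a -> leq_bot (tf (glb A)) (tf a).
Proof.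
move=> Aa p; elim: p A a Aa => [|i p IH] A a Aa.
  rewrite !tf_nil; case: (root_glb_cases A) => [->|/(_ a Aa) ->]; first by split=> //; left.
  by split=> //; right.
rewrite !tf_cons; case: ifP => // hi.
have -> : root a = root (glb A).
  by case: (root_glb_cases A) => [e|->] //; rewrite e in hi.
by rewrite hi child_glb //; apply: IH; exists a.
Qed.

Lemma leq_bot_root (b a : term) : leq_bot (tf b) (tf a) -> root b = LBot \/ root b = root a.
Proof.
move=> /(_ [::]); rewrite !tf_nil => -[] // _ []; first by case; left.
by case; right.
Qed.

Lemma leq_bot_child (b a : term) i : leq_bot (tf b) (tf a) -> i < arty (root b) ->
  leq_bot (tf (child b i)) (tf (child a i)).
Proof.
move=> h hi p; have := h (i :: p); rewrite !tf_cons hi.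
by case: (leq_bot_root h) => e; [rewrite e in hi|rewrite -e hi].
Qed.

Lemma glb_greatest A (b : term) : (exists a, A a) ->
  (forall a, A a -> leq_bot (tf b) (tf a)) -> leq_bot (tf b) (tf (glb A)).
Proof.
move=> ne h p; elim: p A b ne h => [|i p IH] A b [a0 Aa0] h.
all: case: (classic (root b = LBot)) => [e|nb];
  first by apply: leq_bot_node; left.
all: have er : root (glb A) = root b by
  apply: (root_glb Aa0) => a /h /leq_bot_root [].
  by rewrite !tf_nil er; split=> //; right.
rewrite !tf_cons er; case: ifP => // hi; rewrite child_glb ?er //.
apply: IH; first by exists (child a0 i), a0.
by move=> _ [a Aa ->]; apply: leq_bot_child (h a Aa) hi.
Qed.

Section LiminfCriterion.
Variables (I : Type) (lt : I -> I -> Prop) (c : I -> term) (s : term).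
Notation le i j := (i = j \/ lt i j).
Hypothesis le_total : forall i j, le i j \/ le j i.
Hypothesis le_trans : forall i j k, le i j -> le j k -> le i k.
Hypothesis stable : forall p l, tf s p = Some l -> l <> LBot ->
  exists b, forall i, le b i -> tf (c i) p = Some l.
Hypothesis bottom : forall p, tf s p = Some LBot -> forall b, exists2 i, le b i &
  tf (c i) p = Some LBot.

Let tail b a := exists2 i, le b i & a = c i.

Lemma le_sup i j : exists2 k, le i k & le j k.
Proof. by case: (le_total i j) => h; [exists j|exists i] => //; left. Qed.

Lemma tail_inh b : exists a, tail b a.
Proof. by exists (c b), b => //; left. Qed.

Lemma stable_path p l : tf s p = Some l -> l <> LBot ->
  exists b, forall i, le b i -> forall q, prefix q p -> tf (c i) q = tf s q.
Proof.
elim/last_ind: p l => [|p j IH] l e nb.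
  have [b hb] := stable e nb; exists b => i bi q; rewrite prefixs0 => /eqP ->; by rewrite e hb.
have /valid_rcons [v hj] : valid s (rcons p j) by rewrite /valid e.
have [|b1 hb1] := IH _ (tf_root v); first by move=> e1; rewrite e1 in hj.
have [b2 hb2] := stable e nb; have [b h1 h2] := le_sup b1 b2.
exists b => i bi q /prefixP [r]; case/lastP: r => [|r k].
  by rewrite cats0 => <-; rewrite e; apply/hb2/(le_trans h2).
rewrite -rcons_cat => /rcons_inj [ep _]; apply: hb1; first exact: le_trans h1 bi.
by rewrite ep; apply: prefix_prefix.
Qed.

Lemma glb_tail_leq b : leq_bot (tf (glb (tail b))) (tf s).
Proof.
have key p : valid (glb (tail b)) p -> valid s p ->
    tf (glb (tail b)) p = Some LBot \/ tf (glb (tail b)) p = tf s p.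
  move=> v vs; have es := tf_root vs.
  case: (classic (root (at_pos s p) = LBot)) => [e|nb].
    rewrite e in es; have [i bi hi] := bottom es b.
    have /(@glb_lower (tail b)) /(_ p v) : tail b (c i) by exists i.
    by rewrite hi => -[_ [->|->]]; left.
  have [b' hb'] := stable es nb; have [i h1 h2] := le_sup b b'.
  have /(@glb_lower (tail b)) /(_ p v) : tail b (c i) by exists i.
  by rewrite hb' // es => -[_ [->|->]]; [left|right].
move=> p hv; suff vs : valid s p by split=> //; apply: key.
elim/last_ind: p hv => [|p j IH] hv; first exact: valid_nil.
have /valid_rcons [v hj] := hv; have vs := IH v; apply/valid_rcons; split=> //.
case: (key p v vs); rewrite (tf_root v) => -[e]; first by rewrite e in hj.
by move: e; rewrite (tf_root vs) => -[<-].
Qed.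

(** By [bottom], and [stable] for the other labels, [s] bounds all tail infima. By [stable] it is
    least: the path to a label other than [LBot] is shared by a whole tail and so lies below the
    infimum of that tail. *)
Lemma liminf_criterion : is_liminf ar lt (fun _ => True) (fun i => tf (c i)) (tf s).
Proof.
exists (fun b => tf (glb (tail b))); split.
  move=> b _; split; first exact: tf_wf.
  split=> [_ [i [_ [bi ->]]]|u wu hu]; first by apply: glb_lower; exists i.
  apply: (@glb_greatest _ (Term wu)); first exact: tail_inh.
  by move=> _ [i bi ->]; apply: hu; exists i.
split; first exact: tf_wf.
split=> [_ [b [_ ->]]|u wu hu]; first exact: glb_tail_leq.
have key p l : tf s p = Some l -> l <> LBot -> u p = Some l.
  move=> e nb; have [b hb] := stable_path e nb; have v : valid s p by rewrite /valid e.
  have h1 : leq_bot (tf (path_term s p)) (tf (glb (tail b))).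
    apply: glb_greatest; first exact: tail_inh.
    by move=> _ [i bi ->]; apply: path_term_leq => // q; apply: hb.
  have ep := path_term_at v; rewrite e in ep.
  have [] := h1 p; rewrite ep // => v1 [[//]|e1].
  have /(_ p v1) [_] : leq_bot (tf (glb (tail b))) u by apply: hu; exists b.
  by rewrite -e1 => -[[//]|].
(* Where [s] has [LBot], only validity in [u] is at stake, and the label of the parent decides
   it. *)
move=> p v; have e := tf_root v; case: (classic (root (at_pos s p) = LBot)) => [eb|nb].
  split; last by left; rewrite e eb.
  case/lastP: p v {e eb} => [|p j v]; first by case: wu.
  have /valid_rcons [v1 hj] := v; have := key p _ (tf_root v1).
  move=> /(_ _)/(@valid_label (Term wu)) h.
  have [|h1 h2] := h; first by move=> e1; rewrite e1 in hj.
  suff : valid (Term wu) (rcons p j) by [].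
  by apply/valid_rcons; rewrite h2.
by rewrite e (key p _ e nb); split=> //; right.
Qed.

End LiminfCriterion.
End Positions.

(** * Reduction in orthogonal systems *)

Section Star.
Variables (A : Type) (X : A -> A -> Prop).

Inductive star : A -> A -> Prop :=
| star_refl a : star a a
| star_step a b c : X a b -> star b c -> star a c.

Lemma star1 a b : X a b -> star a b.
Proof. by move=> h; apply: star_step h (star_refl _). Qed.

Lemma star_trans a b c : star a b -> star b c -> star a c.
Proof. by elim=> // {}a d {}b h _ IH /IH; apply: star_step. Qed.

Fixpoint power (n : nat) (a c : A) : Prop :=
  if n is m.+1 then exists2 b, X a b & power m b c else a = c.

End Star.

Lemma star_mono A (X Y : A -> A -> Prop) a b : (forall a b, X a b -> Y a b) ->
  star X a b -> star Y a b.
Proof. by move=> h; elim=> [c|c d e /h hcd _]; [apply: star_refl|apply: star_step]. Qed.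

Lemma star_power A (X Y : A -> A -> Prop) a b : (forall a b, X a b -> Y a b) ->
  star X a b -> exists n, power Y n a b.
Proof.
move=> h; elim=> [c|c d e /h hcd _ [n hn]]; first by exists 0.
by exists n.+1; exists d.
Qed.

Lemma wf_measure A (f : A -> nat) : well_founded (fun a b => f a < f b).
Proof.
move=> a; have [n] := ubnP (f a); elim: n a => [//|n IH a].
by rewrite ltnS => h; constructor=> b hb; apply: IH; apply: leq_trans hb h.
Qed.

Section Rewriting.
Variables (F V R : Type) (ar : F -> nat).
Notation term := (term V ar).
Notation arty := (arity ar).
Variables (L Rh : R -> term).
Hypothesis L_tot : forall rho, tot (L rho).
Hypothesis L_fin : forall rho, fin (L rho).
Hypothesis L_lin : forall rho, linear (L rho).
Hypothesis L_nv : forall rho x, root (L rho) <> LVar x.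
Hypothesis Rh_occ : forall rho x, occurs x (Rh rho) -> occurs x (L rho).
(** The substitutions are partial, as they arise in reductions; [p] stands for the subterm of
    [L rho] at [q]. *)
Hypothesis L_over : forall rho rho' q f p sg sg',
  tf (L rho) q = Some (LFun f) -> (forall r, tf p r = tf (L rho) (q ++ r)) ->
  sub p sg = sub (L rho') sg' -> rho = rho' /\ q = [::].

Lemma L_fun rho : exists f, root (L rho) = LFun f.
Proof.
case e: (root (L rho)) => [f|x|]; first by exists f.
- by case: (L_nv e).
- by case: (@L_tot rho [::]); rewrite tf_nil e.
Qed.

Definition red (t s : term) : Prop :=
  exists rho sg, t = sub (L rho) sg /\ s = sub (Rh rho) sg.

(** Two rules applicable at the root overlap there and hence coincide; each variable of the
    right-hand side occurs on the left, where matching determines its value. *)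
Lemma red_fun t s s' : red t s -> red t s' -> s = s'.
Proof.
move=> [rho [sg [-> ->]]] [rho' [sg' [e ->]]].
have [f hf] := L_fun rho.
have hf' : tf (L rho) [::] = Some (LFun f) by rewrite tf_nil hf.
have [er _] := L_over hf' (fun=> erefl) e; move: e; rewrite -{}er => e.
by apply: sub_ext => x /Rh_occ; apply: sub_inj.
Qed.

Lemma red_root t s : red t s -> exists f, root t = LFun f.
Proof.
move=> [rho [sg [-> _]]]; have [f hf] := L_fun rho; exists f.
by rewrite root_sub // hf.
Qed.

Inductive step_at : position -> term -> term -> Prop :=
| step_root t s : red t s -> step_at [::] t s
| step_child i q t s : i < arty (root t) -> step_at q (child t i) s ->
    step_at (i :: q) t (upd t i s).

Definition st t s := exists q, step_at q t s.
Definition nr t s := exists i q, step_at (i :: q) t s.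

Lemma red_st t s : red t s -> st t s.
Proof. by move=> h; exists [::]; constructor. Qed.

Lemma nr_st t s : nr t s -> st t s.
Proof. by move=> [i [q h]]; exists (i :: q). Qed.

Lemma star_nr_st t s : star nr t s -> star st t s.
Proof. exact: star_mono nr_st. Qed.

Lemma st_cases t s : st t s -> red t s \/ nr t s.
Proof.
move=> [q h]; case: h => {q t s} [t s h|i q t s hi h]; first by left.
by right; exists i, q; constructor.
Qed.

Lemma st_upd t i s : i < arty (root t) -> st (child t i) s -> nr t (upd t i s).
Proof. by move=> hi [q h]; exists i, q; constructor. Qed.

Lemma upd_upd (t : term) i s s' : upd (upd t i s) i s' = upd t i s'.
Proof.
apply: term_eq => // j hj; rewrite !child_upd //; by case: eqP.
Qed.

Lemma upd_id (t : term) i : upd t i (child t i) = t.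
Proof. by apply: term_eq => // j hj; rewrite child_upd //; case: eqP => [->|]. Qed.

Lemma star_upd t i s : i < arty (root t) -> star st (child t i) s ->
  star nr t (upd t i s).
Proof.
move=> hi; move e: (child t i) => c h; elim: h t hi e => {c s} [c|a b c hab _ IH] t hi e.
  by rewrite -e upd_id; apply: star_refl.
apply: (@star_step _ _ _ (upd t i b)); first by apply: st_upd; rewrite ?e.
by rewrite -(upd_upd t i b c); apply: IH => //; rewrite child_upd // eqxx.
Qed.

Lemma star_children t (Q : nat -> term -> Prop) :
  (forall i, i < arty (root t) -> exists s, star st (child t i) s /\ Q i s) ->
  exists t', [/\ star nr t t', root t' = root t &
    forall i, i < arty (root t) -> Q i (child t' i)].
Proof.
(* Generalised for an induction on the number of arguments already treated: the second bound becomes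
   [k], and the arguments from [k] on are still unchanged. *)
move=> h; suff [t' [h1 h2 h3]] : exists t', [/\ star nr t t', root t' = root t &
    forall i, i < arty (root t) -> if i < arty (root t) then Q i (child t' i)
      else child t' i = child t i].
  by exists t'; split=> // i hi; have := h3 i hi; rewrite hi.
elim: {2}(arty (root t)) => [|k [t' [h1 h2 h3]]].
  by exists t; split=> //; apply: star_refl.
case: (ltnP k (arty (root t))) => hk; last first.
  exists t'; split=> // i hi; have := h3 i hi.
  by rewrite (leq_trans hi hk) (leq_trans hi (leq_trans hk (leqnSn k))).
have := h3 k hk; rewrite ltnn => ek.
have [s [hs hq]] := h k hk.
have hk' : k < arty (root t') by rewrite h2.
exists (upd t' k s); split=> //.
  by apply: star_trans h1 _; apply: star_upd; rewrite ?ek.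
move=> i hi; rewrite child_upd ?h2 //; have := h3 i hi.
have -> : (i < k.+1) = (i == k) || (i < k) by rewrite ltnS leq_eqVlt.
by case: eqP => [->|_].
Qed.

Lemma nr_root t s : nr t s -> root s = root t.
Proof. by move=> [i [q h]]; inversion h. Qed.

Lemma nr_child t s i : nr t s -> i < arty (root t) ->
  child t i = child s i \/ st (child t i) (child s i).
Proof.
move=> [j [q h]] hi; inversion h; subst; rewrite child_upd //.
by case: eqP => [->|]; [right; exists q|left].
Qed.

Lemma star_st_first t s : star st t s ->
  star nr t s \/ exists t' t'', [/\ star nr t t', red t' t'' & star st t'' s].
Proof.
elim=> [a|a b c /st_cases[hab hbc _|hab _ IH]]; first by left; apply: star_refl.
  by right; exists a, b; split=> //; apply: star_refl.
case: IH => [h|[t' [t'' [h1 h2 h3]]]]; first by left; apply: star_step hab h.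
by right; exists t', t''; split=> //; apply: star_step hab h1.
Qed.

(** * Root-active terms and the relation [inf] *)

Definition ra_body (X : term -> Prop) t :=
  exists t' t'', [/\ star nr t t', red t' t'' & X t''].

(** A greatest fixed point, encoded as the union of all post-fixed points, like [inf] and [par]
    below: coinduction amounts to giving an invariant, without guardedness conditions. *)
Definition ra t := exists2 X : term -> Prop, (forall t, X t -> ra_body X t) & X t.

Lemma ra_unfold t : ra t -> ra_body ra t.
Proof.
move=> [X hX /hX [t' [t'' [h1 h2 h3]]]]; exists t', t''; split=> //.
by exists X.
Qed.

(** Root steps are allowed before the exhibited contraction: [star_st_first] cuts at the first one,
    and [Y] remembers the rest of the reduction. *)
Lemma ra_coind (X : term -> Prop) :
  (forall t, X t -> exists t' t'', [/\ star st t t', red t' t'' & X t'' \/ ra t'']) ->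
  forall t, X t -> ra t.
Proof.
move=> hX t hx.
pose Y t := exists t' t'', [/\ star st t t', red t' t'' & X t'' \/ ra t''].
have XY u : X u \/ ra u -> Y u.
  case=> [/hX //|/ra_unfold [u' [u'' [h1 h2 h3]]]].
  by exists u', u''; split=> //; [apply: star_nr_st|right].
exists Y; last by apply: XY; left.
move=> {hx}u [u' [u'' [/star_st_first h1 h2 h3]]].
case: h1 => [h1|[v [v' [h1 h1' h1'']]]].
  by exists u', u''; split=> //; apply: XY.
by exists v, v'; split=> //; exists u', u''.
Qed.

Lemma ra_star t t' t'' : star st t t' -> red t' t'' -> ra t'' -> ra t.
Proof.
move=> h1 h2 h3; apply: (@ra_coind (fun u => u = t)) => // u ->.
by exists t', t''; split=> //; right.
Qed.

Definition inf_body (X : term -> term -> Prop) t s :=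
  (exists t', [/\ star st t t', root t' = root s &
     forall i, i < arty (root s) -> X (child t' i) (child s i)]) \/
  (s = botT V ar /\ ra t).

Definition inf t s :=
  exists2 X : term -> term -> Prop, (forall t s, X t s -> inf_body X t s) & X t s.

Lemma inf_body_mono (X Y : term -> term -> Prop) t s :
  (forall t s, X t s -> Y t s) -> inf_body X t s -> inf_body Y t s.
Proof.
move=> h [[t' [h1 h2 h3]]|h']; last by right.
by left; exists t'; split=> // i /h3 /h.
Qed.

Lemma inf_unfold t s : inf t s -> inf_body inf t s.
Proof. by move=> [X hX /hX]; apply: inf_body_mono => u v; exists X. Qed.

Lemma inf_coind (X : term -> term -> Prop) :
  (forall t s, X t s -> inf_body (fun t s => X t s \/ inf t s) t s) ->
  forall t s, X t s -> inf t s.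
Proof.
move=> hX t s hx; exists (fun t s => X t s \/ inf t s); last by left.
move=> u v [/hX //|/inf_unfold]; apply: inf_body_mono => ? ?; by right.
Qed.

Lemma inf_fold t s : inf_body inf t s -> inf t s.
Proof.
move=> h; apply: (@inf_coind (fun a b => a = t /\ b = s)) => // a b [-> ->].
by apply: inf_body_mono h => ? ?; right.
Qed.

Lemma inf_refl t : inf t t.
Proof.
apply: (@inf_coind eq) => // a b ->; left; exists b; split=> //; last by left.
exact: star_refl.
Qed.

Lemma inf_absorb t t' s : star st t t' -> inf t' s -> inf t s.
Proof.
move=> h /inf_unfold [[u [h1 h2 h3]]|[-> hr]]; apply: inf_fold.
  by left; exists u; split=> //; apply: star_trans h h1.
right; split=> //; case/ra_unfold: hr => [u [v [h1 h2 h3]]].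
by apply: ra_star h2 h3; apply: star_trans h (star_nr_st h1).
Qed.

Lemma inf_sub p sg sg' : (forall x, inf (sg x) (sg' x)) -> inf (sub p sg) (sub p sg').
Proof.
move=> h; apply: (@inf_coind (fun a b => exists p, a = sub p sg /\ b = sub p sg'));
  last by exists p.
move=> a b [{}p [-> ->]].
case: (classic (isvar p)) => [[x e]|/not_isvar nv].
  rewrite !(sub_var _ e); apply: inf_body_mono (inf_unfold (h x)) => ? ?; by right.
left; exists (sub p sg); split; [exact: star_refl|by rewrite !root_sub|].
rewrite root_sub // => i hi; left; exists (child p i).
by rewrite !child_sub.
Qed.

(** [inf] is unfolded once per function symbol of the finite pattern, so finitely many steps
    suffice; the [LBot] alternative cannot occur at a function symbol. *)
Lemma inf_pat (Z : V -> term -> Prop) p t s : pat Z p s -> inf t s ->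
  exists2 t', star st t t' & pat (fun x c => exists2 c0, Z x c0 & inf c c0) p t'.
Proof.
move=> hp; elim: hp t => {p s} [p x b e hz|p f b e e' _ IH] t ht.
  by exists t; [apply: star_refl|apply: (pat_var e); exists b].
case/inf_unfold: ht => [[t' [h1 h2 h3]]|[eb _]]; last by rewrite eb in e'.
have [|t'' [h4 h5 h6]] := @star_children t' (fun i c =>
    pat (fun x c => exists2 c0, Z x c0 & inf c c0) (child p i) c).
  rewrite h2 e' /= => i hi; have := h3 i; rewrite e' => /(_ hi) /IH.
  by case=> // s hs hq; exists s.
exists t''; first by apply: star_trans h1 (star_nr_st h4).
apply: (pat_fun e) => [|i hi]; first by rewrite h5 h2.
by apply: h6; rewrite h2 e'.
Qed.

Lemma L_pat rho sg : pat (fun x b => b = sg x) (L rho) (sub (L rho) sg).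
Proof. exact: pat_sub. Qed.

(** Left-finiteness completes the pattern in finitely many steps; left-linearity makes the result an
    instance although the arguments are reduced independently. *)
Lemma inf_red t s s' : inf t s -> red s s' ->
  exists t' t'', [/\ star st t t', red t' t'' & inf t'' s'].
Proof.
move=> ht [rho [sg [es es']]]; rewrite {}es in ht.
have [t' h1 h2] := inf_pat (L_pat rho sg) ht.
have [|sg' [e h3]] := pat_inst (@L_lin rho) _ h2.
  by move=> x; exists (sg x), (sg x) => //; apply: inf_refl.
exists t', (sub (Rh rho) sg'); split=> //; first by exists rho, sg'.
by rewrite es'; apply: inf_sub => x; case: (h3 x) => c0 ->.
Qed.

Lemma inf_step t s s' : inf t s -> st s s' -> inf t s'.
Proof.
move=> + [q h]; elim: h t => {q s s'} [s s' h|i q s s' hi _ IH] t ht.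
  have [t' [t'' [h1 h2 h3]]] := inf_red ht h.
  by apply: inf_absorb h3; apply: star_trans h1 (star1 (red_st h2)).
case/inf_unfold: (ht) => [[t' [h1 h2 h3]]|[eb _]]; last by rewrite eb in hi.
apply: inf_fold; left; exists t'; split=> // j hj; rewrite child_upd //.
by case: eqP => [->|_]; [apply/IH/h3|apply: h3].
Qed.

Lemma inf_steps t s s' : inf t s -> star st s s' -> inf t s'.
Proof. by move=> + h; elim: h => // a b c hab _ IH /inf_step/(_ hab). Qed.

Lemma inf_ra t s : inf t s -> ra s -> ra t.
Proof.
move=> hi hs; apply: (@ra_coind (fun t => exists2 s, inf t s & ra s)); last by exists s.
move=> {hi hs s}t [s hi /ra_unfold [s' [s'' [h1 h2 h3]]]].
have [t' [t'' [h4 h5 h6]]] := inf_red (inf_steps hi (star_nr_st h1)) h2.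
by exists t', t''; split=> //; left; exists s''.
Qed.

(** The finite reduction from [s] that produces the root of [u] is absorbed into [inf t s] by
    [inf_steps]; then the roots can be compared and the arguments left to coinduction. *)
Lemma inf_trans t s u : inf t s -> inf s u -> inf t u.
Proof.
move=> h1 h2; apply: (@inf_coind (fun t u => exists2 s, inf t s & inf s u));
  last by exists s.
move=> {h1 h2 s}t {}u [s h1 /inf_unfold [[s' [h2 h3 h4]]|[-> h2]]]; last first.
  by right; split=> //; apply: inf_ra h1 h2.
case/inf_unfold: (inf_steps h1 h2) => [[t' [h5 h6 h7]]|[eb hr]].
  left; exists t'; split=> //; first by rewrite h6.
  by move=> i hi; left; exists (child s' i); [apply: h7; rewrite h3|apply: h4].
by right; split=> //; apply: root_bot; rewrite -h3 eb.
Qed.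

(** A coinductive parallel step: it contracts a possibly infinite set of disjoint redexes, since
    contracting one redex may create infinitely many copies of another when right-hand sides are
    infinite. Nested redexes never arise, so no infinite collapse has to be handled. *)
Definition par_body (X : term -> term -> Prop) t s :=
  red t s \/ (root t = root s /\ forall i, i < arty (root t) -> X (child t i) (child s i)).

Definition par t s :=
  exists2 X : term -> term -> Prop, (forall t s, X t s -> par_body X t s) & X t s.

Definition parn t s :=
  root t = root s /\ forall i, i < arty (root t) -> par (child t i) (child s i).

Lemma par_body_mono (X Y : term -> term -> Prop) t s :
  (forall t s, X t s -> Y t s) -> par_body X t s -> par_body Y t s.
Proof. by move=> h [h'|[h1 h2]]; [left|right; split=> // i /h2 /h]. Qed.

Lemma par_unfold t s : par t s -> par_body par t s.
Proof. by move=> [X hX /hX]; apply: par_body_mono => u v; exists X. Qed.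

Lemma par_coind (X : term -> term -> Prop) :
  (forall t s, X t s -> par_body (fun t s => X t s \/ par t s) t s) ->
  forall t s, X t s -> par t s.
Proof.
move=> hX t s hx; exists (fun t s => X t s \/ par t s); last by left.
move=> u v [/hX //|/par_unfold]; apply: par_body_mono => ? ?; by right.
Qed.

Lemma par_fold t s : par_body par t s -> par t s.
Proof.
move=> h; apply: (@par_coind (fun a b => a = t /\ b = s)) => // a b [-> ->].
by apply: par_body_mono h => ? ?; right.
Qed.

Lemma par_refl t : par t t.
Proof. by apply: (@par_coind eq) => // a b ->; right; split=> // i hi; left. Qed.

Lemma red_par t s : red t s -> par t s.
Proof. by move=> h; apply: par_fold; left. Qed.

Lemma parn_par t s : parn t s -> par t s.
Proof. by move=> h; apply: par_fold; right. Qed.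

Lemma par_sub p sg sg' : (forall x, par (sg x) (sg' x)) -> par (sub p sg) (sub p sg').
Proof.
move=> h; apply: (@par_coind (fun a b => exists p, a = sub p sg /\ b = sub p sg'));
  last by exists p.
move=> a b [{}p [-> ->]].
case: (classic (isvar p)) => [[x e]|/not_isvar nv].
  rewrite !(sub_var _ e); apply: par_body_mono (par_unfold (h x)) => ? ?; by right.
right; split; first by rewrite !root_sub.
by rewrite root_sub // => i hi; left; exists (child p i); rewrite !child_sub.
Qed.

Lemma st_par t s : st t s -> par t s.
Proof.
move=> [q]; elim=> {q t s} [t s /red_par //|i q t s hi _ IH].
apply/parn_par; split=> // j hj; rewrite child_upd //.
by case: eqP => [->|_] //; apply: par_refl.
Qed.

Lemma nr_parn t s : nr t s -> parn t s.
Proof.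
move=> h; split; first by rewrite (nr_root h).
move=> i /(nr_child h) [->|/st_par //]; exact: par_refl.
Qed.

Lemma par_inf t s : par t s -> inf t s.
Proof.
move=> h; apply: (@inf_coind par) h => {}t {}s /par_unfold [h|[h1 h2]].
  left; exists s; split=> //; first exact: star1 (red_st h).
  by move=> i hi; right; apply: inf_refl.
left; exists t; split=> //; first exact: star_refl.
by move=> i hi; left; apply: h2; rewrite h1.
Qed.

(** * Patterns under parallel steps, and the diamond property *)

Inductive subpat : term -> Prop :=
| subpat_top rho i : i < arty (root (L rho)) -> subpat (child (L rho) i)
| subpat_child p i : subpat p -> i < arty (root p) -> subpat (child p i).

Lemma subpat_at p : subpat p ->
  exists rho i q, forall r, tf p r = tf (L rho) (i :: q ++ r).
Proof.
elim=> {p} [rho i hi|p i _ [rho [j [q h]]] hi].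
  by exists rho, i, [::] => r; rewrite tf_cons hi.
exists rho, j, (rcons q i) => r; rewrite cat_rcons -h tf_cons hi //.
Qed.

Lemma subpat_fin p : subpat p -> fin p.
Proof. by elim=> {p} [rho i hi|p i _ [h] /h //]; case: (L_fin rho) => /(_ i hi). Qed.

Lemma subpat_lin p : subpat p -> linear p.
Proof. by elim=> {p} [rho i hi|p i _ h hi]; apply: linear_child. Qed.

Notation skel := (@pat F V ar (fun _ _ => True)).

Lemma skel_pat X p b : pat X p b -> skel p b.
Proof. exact: pat_mono. Qed.

Lemma skel_red rho t : skel (L rho) t -> exists s, red t s.
Proof.
move=> /(pat_inst (@L_lin rho)) [|sg [-> _]]; first by exists (botT V ar).
by exists (sub (Rh rho) sg), rho, sg.
Qed.

(** By linearity [t] is an instance of [p]; a redex there would overlap a left-hand side at the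
    non-root position [i :: q]. *)
Lemma skel_no_red p t s f : subpat p -> root p = LFun f -> skel p t -> ~ red t s.
Proof.
move=> hp e /(pat_inst (subpat_lin hp)) [|sg [-> _]]; first by exists (botT V ar).
move=> [rho [sg' [e' _]]]; have [rho' [i [q h]]] := subpat_at hp.
have [] // := @L_over rho' rho (i :: q) f p sg sg' _ h e'.
by rewrite -[q]cats0 -h tf_nil e.
Qed.

(** No function symbol of [p] is the root of a redex, so the step acts only inside the parts matched
    by variables. *)
Lemma pat_par Z p a b : subpat p -> pat Z p a -> par a b ->
  pat (fun x c' => exists2 c, Z x c & par c c') p b.
Proof.
move=> hp h; elim: h b hp => {p a} [p x a e hz|p f a e e' hc IH] b hp hb.
  by apply: (pat_var e); exists a.
case/par_unfold: (hb) => [h|[h1 h2]].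
  by case: (skel_no_red hp e (skel_pat (pat_fun e e' hc)) h).
apply: (pat_fun e); first by rewrite -h1.
move=> i hi; apply: IH => //; last by apply: h2; rewrite e'.
by apply: subpat_child; rewrite // e.
Qed.

Lemma parn_L rho sg s : parn (sub (L rho) sg) s ->
  exists sg', s = sub (L rho) sg' /\ forall x, par (sg x) (sg' x).
Proof.
move=> [h1 h2]; have [f e] := L_fun rho.
have nv x : root (L rho) <> LVar x by rewrite e.
rewrite root_sub // e in h1 h2.
have hp : pat (fun x c => exists2 c0, c0 = sg x & par c0 c) (L rho) s.
  apply: (pat_fun e) => // i hi.
  have hi' : i < arty (root (L rho)) by rewrite e.
  apply: (pat_par (subpat_top hi') _ (h2 _ hi)); rewrite child_sub //.
  apply: pat_sub; last exact: tot_child.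
  by case: (L_fin rho) => /(_ i hi').
have [|sg' [-> h]] := pat_inst (@L_lin rho) _ hp.
  by move=> x; exists (sg x), (sg x) => //; apply: par_refl.
by exists sg'; split=> // x; case: (h x) => c ->.
Qed.

Lemma parn_red t s u : parn t s -> red t u -> exists2 w, red s w & par u w.
Proof.
move=> h [rho [sg [e ->]]]; rewrite {}e in h.
have [sg' [-> h']] := parn_L h.
by exists (sub (Rh rho) sg'); [exists rho, sg'|apply: par_sub].
Qed.

(** State [inr (t, s, u)] asks for a join of [s] and [u]. If one side contracts the root and a join
    exists, one is chosen and copied through [inl]; otherwise the search descends to the
    arguments. *)
Definition close_step (a : term + term * term * term) :
    lab F V * (nat -> term + term * term * term) :=
  match a with
  | inl t => (root t, fun i => inl (child t i))
  | inr (t, s, u) =>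
    match excluded_middle_informative (exists w, par s w /\ par u w /\
      (red t s \/ red t u)) with
    | left h => let w := proj1_sig (constructive_indefinite_description _ h) in
                (root w, fun i => inl (child w i))
    | right _ => (root t, fun i => inr (child t i, child s i, child u i))
    end
  end.

Lemma unfold_close_inl t : unfold ar close_step (inl t) = t.
Proof.
apply: (@bisim _ _ _ (fun a b => a = unfold ar close_step (inl b))) => // a b -> {a}.
by split=> // i hi; rewrite child_unfold.
Qed.

(** Infinitely many redexes may have to be joined, so the join is built by corecursion and both
    closing steps are checked by coinduction. In [key], two root contractions agree by [red_fun], a
    single one is closed by [parn_red], and otherwise the arguments remain. *)
Lemma par_diamond t s u : par t s -> par t u -> exists2 w, par s w & par u w.
Proof.
pose W t s u := unfold ar close_step (inr (t, s, u)).
have key t' s' u' : par t' s' -> par t' u' ->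
   (par s' (W t' s' u') /\ par u' (W t' s' u')) \/
   [/\ root t' = root s', root t' = root u', root t' = root (W t' s' u') &
    forall i, i < arty (root t') -> [/\ par (child t' i) (child s' i),
      par (child t' i) (child u' i) &
      child (W t' s' u') i = W (child t' i) (child s' i) (child u' i)]].
  move=> hs hu.
  case ex: (excluded_middle_informative (exists w, par s' w /\ par u' w /\
      (red t' s' \/ red t' u'))) => [h|h].
    set w := proj1_sig (constructive_indefinite_description _ h).
    have -> : W t' s' u' = w.
      apply: term_eq; first by rewrite root_unfold /= ex.
      rewrite root_unfold /= ex => i hi.
      by rewrite child_unfold /= ex // unfold_close_inl.
    have [h1 [h2 _]] : par s' w /\ par u' w /\ (red t' s' \/ red t' u').
      by rewrite /w; case: constructive_indefinite_description.
    by left.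
  right; case/par_unfold: hs => [hs|hs]; case/par_unfold: hu => [hu|hu].
  - case: (h); exists s'; rewrite (red_fun hs hu).
    by split; [apply: par_refl|split; [apply: par_refl|left; rewrite -(red_fun hs hu)]].
  - have [w h1 h2] := parn_red hu hs; case: (h); exists w.
    by split=> //; split; [apply: red_par|left].
  - have [w h1 h2] := parn_red hs hu; case: (h); exists w.
    by split; [apply: red_par|split=> //; right].
  - case: hs hu => [h1 h2] [h3 h4]; split=> //; first by rewrite root_unfold /= ex.
    move=> i hi; split; [exact: h2|exact: h4|].
    by rewrite child_unfold /= ex.
move=> hs hu; exists (W t s u).
  apply: (@par_coind (fun a b => exists t u, [/\ par t a, par t u & b = W t a u]));
    last by exists t, u.
  move=> {t u hs hu}s w [t [u [hs hu ->]]].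
  case: (key _ _ _ hs hu) => [[h _]|[h1 h2 h3 h4]].
    by apply: par_body_mono (par_unfold h) => ? ?; right.
  right; rewrite -h1; split=> // i hi; left; exists (child t i), (child u i).
  by case: (h4 i hi).
apply: (@par_coind (fun a b => exists t s, [/\ par t a, par t s & b = W t s a]));
  last by exists t, s.
move=> {t s hs hu}u w [t [s [hu hs ->]]].
case: (key _ _ _ hs hu) => [[_ h]|[h1 h2 h3 h4]].
  by apply: par_body_mono (par_unfold h) => ? ?; right.
right; rewrite -h2; split=> // i hi; left; exists (child t i), (child s i).
by case: (h4 i hi).
Qed.

Lemma parn_diamond t s u : parn t s -> parn t u -> exists2 w, parn s w & parn u w.
Proof.
move=> [h1 h2] [h3 h4].
have /choice [ws hw] : forall i, exists w, i < arty (root t) ->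
    par (child s i) w /\ par (child u i) w.
  move=> i; case hi: (i < arty (root t)); last by exists t.
  by have [w] := par_diamond (h2 i hi) (h4 i hi); exists w.
by exists (node (root t) ws); split=> //; rewrite -?h1 -?h3 // => i hi;
  rewrite child_node //; case: (hw i hi).
Qed.

Lemma par_strip t s n u : par t s -> power par n t u ->
  exists2 w, power par n s w & par u w.
Proof.
elim: n t s => [|n IH] t s h /=; first by move=> <-; exists s.
move=> [v hv hvu]; have [w1 hw1 hw2] := par_diamond h hv.
by have [w hw hw'] := IH _ _ hw2 hvu; exists w => //; exists w1.
Qed.

Lemma star_strip t s n u : star st t s -> power par n t u ->
  exists2 w, power par n s w & star par u w.
Proof.
move=> h; elim: h u => {t s} [t|t s v hts _ IH] u hu; first by exists u => //; apply: star_refl.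
have [w h1 h2] := par_strip (st_par hts) hu.
by have [w' h3 h4] := IH _ h1; exists w' => //; apply: star_step h2 h4.
Qed.

(** Projecting a finite reduction over a parallel step gives possibly infinite steps, so the
    invariant keeps [s] related to the projected term only by [inf], and [inf_red] recovers the root
    contractions. If the parallel step contracts the root, the non-root steps to [t'] stay inside
    that same redex, so [inf s' t''] holds and [inf_ra] applies. *)
Lemma ra_par t s : ra t -> par t s -> ra s.
Proof.
move=> ht hs; apply: (@ra_coind (fun s => exists t s', [/\ ra t, par t s' & inf s s']));
  last by exists t, s; split=> //; apply: inf_refl.
move=> {t ht hs}s [t [s' [/ra_unfold [t' [t'' [h1 h2 h3]]] hp hi]]].
have hra : ra s -> exists t' t'', [/\ star st s t', red t' t'' &
    (exists t s', [/\ ra t, par t s' & inf t'' s']) \/ ra t''].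
  move=> /ra_unfold [a [b [ha hb hc]]]; exists a, b.
  by split=> //; [apply: star_nr_st|right].
case/par_unfold: hp => [[rho [sg [e e']]]|hp].
  apply: hra; apply: inf_ra hi _.
  have [sg' [e1 h4]] : exists sg', t' = sub (L rho) sg' /\ forall x, inf (sg x) (sg' x).
    elim: h1 sg e {e' h2 h3} => [a|a b c hab _ IH] sg e.
      by exists sg; split=> // x; apply: inf_refl.
    rewrite {}e in hab; have [sg1 [e1 h5]] := parn_L (nr_parn hab).
    have [sg2 [e2 h6]] := IH _ e1; exists sg2; split=> // x.
    by apply: inf_trans (h6 x); apply/par_inf/h5.
  have e2 : t'' = sub (Rh rho) sg' by apply: (red_fun h2); exists rho, sg'.
  by apply: inf_ra h3; rewrite e' e2; apply: inf_sub.
have [w h4 h5] : exists2 w, parn t' w & inf s w.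
  elim: h1 s' hp hi {h2 h3} => [a|a b c hab _ IH] s' hp hi; first by exists s'.
  have [w h4 h5] := parn_diamond (nr_parn hab) hp.
  by apply: IH h4 _; apply: inf_trans hi _; apply/par_inf/parn_par.
have [w' h6 h7] := parn_red h4 h2.
have [s1 [s2 [h8 h9 h10]]] := inf_red h5 h6.
by exists s1, s2; split=> //; left; exists t'', w'.
Qed.

Definition rs t := forall t' t'', star st t t' -> ~ red t' t''.

Lemma rs_ra t : rs t -> ~ ra t.
Proof. by move=> h /ra_unfold [t' [t'' [/star_nr_st h1 h2 _]]]; apply: h h1 h2. Qed.

(** A term without root-stable reduct reaches a redex, whose contractum again has no root-stable
    reduct; this repeats forever. *)
Lemma ra_or_rs t : ra t \/ exists2 s, star st t s & rs s.
Proof.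
case: (classic (exists2 s, star st t s & rs s)) => [h|h]; first by right.
left; apply: (@ra_coind (fun t => ~ exists2 s, star st t s & rs s)) h => {}t h.
apply: NNPP => no; apply: (h); exists t; first exact: star_refl.
move=> t' t'' h1 h2; apply: no; exists t', t''; split=> //; left => -[s h3 h4].
apply: h; exists s => //.
by apply: star_trans h1 _; apply: star_step (red_st h2) h3.
Qed.

Lemma ra_power n t s : ra t -> power par n t s -> ra s.
Proof.
elim: n t => [|n IH] t h /=; first by move=> <-.
by move=> [u /(ra_par h) hu]; apply: IH.
Qed.

(** [pat_par] preserves the match along every reduction, and [skel_no_red] excludes a redex at its
    root. *)
Lemma skel_rs p f c : subpat p -> root p = LFun f -> skel p c -> rs c.
Proof.
move=> hp e hc t' t'' h; elim: h hc => [a|a b d hab _ IH] hc; first exact: (skel_no_red hp e hc).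
by apply: IH; apply: skel_pat (pat_par hp hc (st_par hab)).
Qed.

Lemma power_first m v c : power par m v c -> power parn m v c \/
  exists j d d', [/\ j < m, power parn j v d & red d d'].
Proof.
elim: m v => [|m IH] v /=; first by left.
move=> [w /par_unfold hw /IH]; case: hw => [hw _|hw]; first by right; exists 0, v, w.
case=> [h|[j [d [d' [h1 h2 h3]]]]]; first by left; exists w.
by right; exists j.+1, d, d'; split=> //=; exists w.
Qed.

Lemma power_parn m v c : power parn m v c -> root v = root c /\
  forall i, i < arty (root v) -> power par m (child v i) (child c i).
Proof.
elim: m v => [|m IH] v /=; first by move=> ->.
move=> [w [h1 h2] /IH [h3 h4]]; rewrite h1; split=> // i hi.
by exists (child w i); [apply: h2; rewrite h1|apply: h4].
Qed.

(** * Root-stable reducts and confluence *)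

(** The [j] steps before the contraction act on the arguments of [v], which thus reach the argument
    patterns of a left-hand side in [j] steps. The first hypothesis carries these patterns over to
    [y'], where they form a redex. Keeping it a hypothesis lets the lemma serve both inside the
    induction of [reach_skel] and after it. *)
Lemma reach_red j v y' l d : (forall p x c y, subpat p -> power par j x c -> skel p c ->
  inf x y -> exists2 y', star st y y' & skel p y') ->
  root v = root y' -> (forall i, i < arty (root y') -> inf (child v i) (child y' i)) ->
  power parn j v d -> red d l -> ~ rs y'.
Proof.
move=> IH e hc /power_parn [e1 h1] hd; case: (hd) => rho [sg [ed _]] hrs.
have [f ef] := L_fun rho.
have ed' : root d = LFun f by rewrite ed root_sub // ef.
have [|y'' [h2 h3 h4]] := @star_children y' (fun i c => skel (child (L rho) i) c).
  rewrite -e => i hi; have hi' : i < arty (root (L rho)) by rewrite ef -ed' -e1.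
  have [||y3 h5 h6] := IH _ _ _ (child y' i) (subpat_top hi') (h1 i hi).
  - apply: skel_pat; rewrite ed child_sub //; apply: (@pat_sub _ _ _ _ sg); last exact: tot_child.
    by case: (L_fin rho) => /(_ i hi').
  - by apply: hc; rewrite -e.
  by exists y3.
have : skel (L rho) y''.
  apply: (pat_fun ef) => [|i hi]; first by rewrite h3 -e e1.
  by apply: h4; rewrite -e e1 ed'.
by move=> /skel_red [u]; apply: hrs (star_nr_st h2).
Qed.

(** Induction on [m], then on [p]. As [c] is root-stable, [y] reduces to a root-stable term [y'], and
    [x] reduces to some [v] with the root of [y'], whose arguments are related to those of [y']. The
    steps from [x] to [c], projected along [x] to [v], lead from [v] to an instance of [p]; if one
    of them is a root step, then fewer steps lead from the arguments of [v] to those of a redex, and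
    by induction [y'] is not root-stable. *)
Lemma reach_skel m : forall p x c y, subpat p -> power par m x c -> skel p c ->
  inf x y -> exists2 y', star st y y' & skel p y'.
Proof.
elim/ltn_ind: m => m IHm p x c y hp; have fp := subpat_fin hp; elim: fp x c y hp => {}p _ IHp x c y hp.
move=> hm hc hxy; case ep: (root p) => [f|z|]; last first.
- by case: hc ep => [q z b e _|q f b e _ _]; rewrite e.
- by exists y; [apply: star_refl|apply: (pat_var ep)].
(* Otherwise [c] would be root-active by [ra_power], but it is root-stable as an instance of a
   proper subpattern. *)
have hra : ~ ra x by move=> /ra_power /(_ hm); apply/rs_ra/(skel_rs hp ep hc).
case: (ra_or_rs y) => [/(inf_ra hxy) //|[y' hy hrs]].
case/inf_unfold: (inf_steps hxy hy) => [[v [h1 h2 h3]]|[_ //]].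
have [c1 h4 h5] := star_strip h1 hm.
have hc1 : skel p c1.
  elim: h5 hc {hm h4} => // a b d hab _ IH hc.
  by apply: IH; apply: skel_pat (pat_par hp hc hab).
case: (power_first h4) => [/power_parn [e1 h6]|[j [d [d' [hj h6 h7]]]]]; last first.
  by case: (reach_red (IHm j hj) h2 h3 h6 h7).
have {hc1} [e2 hcc] : root c1 = LFun f /\
    forall i, i < ar f -> skel (child p i) (child c1 i).
  case: hc1 ep => [q z b e _|q g b e e' h]; rewrite e => // -[<-] //.
have [|y'' [h7 h8 h9]] := @star_children y' (fun i c => skel (child p i) c).
  rewrite -h2 e1 e2 => i hi; have hi' : i < arty (root p) by rewrite ep.
  have [||||y3 h10 h11] := IHp i hi' (child v i) (child c1 i) (child y' i).
  - exact: subpat_child.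
  - by apply: h6; rewrite e1 e2.
  - exact: hcc.
  - by apply: h3; rewrite -h2 e1 e2.
  by exists y3.
exists y''; first by apply: star_trans hy (star_nr_st h7).
apply: (pat_fun ep) => [|i hi]; first by rewrite h8 -h2 e1.
by apply: h9; rewrite -h2 e1 e2.
Qed.

Lemma rs_back v y : root v = root y ->
  (forall i, i < arty (root y) -> inf (child v i) (child y i)) -> rs y -> rs v.
Proof.
move=> e h hy t' t'' /star_st_first h1 h2.
have [d [d' [h3 h4]]] : exists d d', star nr v d /\ red d d'.
  by case: h1 => [h1|[d [d' [h3 h4 _]]]]; [exists t', t''|exists d, d'].
have [j hj] := star_power nr_parn h3.
exact: (reach_red (@reach_skel j) e h hj h4 hy).
Qed.

Inductive zig : term -> term -> Prop :=
| zig_refl t : zig t t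
| zig_l t s u : inf s t -> zig s u -> zig t u
| zig_r t s u : inf t s -> zig s u -> zig t u.

Lemma zig_trans t s u : zig t s -> zig s u -> zig t u.
Proof.
elim=> {t s} // [t v s h _ IH /IH|t v s h _ IH /IH]; [exact: zig_l|exact: zig_r].
Qed.

Lemma zig_sym t s : zig t s -> zig s t.
Proof.
elim=> {t s} [t|t s u h _ IH|t s u h _ IH]; first exact: zig_refl.
- by apply: zig_trans IH _; apply: zig_r h (zig_refl _).
- by apply: zig_trans IH _; apply: zig_l h (zig_refl _).
Qed.

(** [LBot] is root-stable as well; it is excluded because [inf x (botT V ar)] also admits
    root-active [x]. *)
Definition stable_reduct t t' := [/\ star st t t', rs t' & root t' <> LBot].

Definition zig_children t s := root t = root s /\
  forall i, i < arty (root t) -> zig (child t i) (child s i).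

Lemma zig_children_trans t s u :
  zig_children t s -> zig_children s u -> zig_children t u.
Proof.
move=> [h1 h2] [h3 h4]; split=> [|i hi]; first by rewrite h1.
by apply: zig_trans (h2 i hi) _; apply: h4; rewrite -h1.
Qed.

Lemma stable_bwd x y y' : inf x y -> stable_reduct y y' ->
  exists2 x', stable_reduct x x' & zig_children y' x'.
Proof.
move=> h [h1 h2 h3]; case/inf_unfold: (inf_steps h h1) => [[x' [h4 h5 h6]]|[eb _]];
  last by rewrite eb in h3.
exists x'.
  by split=> //; [apply: (rs_back h5)|rewrite h5].
by split=> // i hi; apply: zig_l (h6 i hi) (zig_refl _).
Qed.

Lemma power_par_inf n t s : power par n t s -> inf t s.
Proof.
elim: n t => [|n IH] t /=; first by move=> ->; apply: inf_refl.
by move=> [u /par_inf h /IH]; apply: inf_trans.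
Qed.

Lemma rs_inf t s : inf t s -> rs t -> rs s.
Proof.
move=> h ht s' s'' h1 /(inf_red (inf_steps h h1)) [t' [t'' [h2 h3 _]]].
exact: ht h2 h3.
Qed.

(** Like [x], [y] is not root-active, so it has a root-stable reduct [y'], and [x] reaches some [v]
    with the root of [y'], root-stable by [rs_back]. Projection gives a common parallel reduct [w]
    of [v] and [x']; both being root-stable, no step to [w] contracts the root, so the arguments are
    convertible. *)
Lemma stable_fwd x y x' : inf x y -> stable_reduct x x' ->
  exists2 y', stable_reduct y y' & zig_children x' y'.
Proof.
move=> h [h1 h2 h3]; have [n hn] := star_power st_par h1.
have nra : ~ ra x by move=> /ra_power /(_ hn); apply: rs_ra.
case: (ra_or_rs y) => [/(inf_ra h) //|[y' hy hrs]].
case/inf_unfold: (inf_steps h hy) => [[v [h4 h5 h6]]|[_ //]].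
have hv : rs v by apply: rs_back hrs.
have [w hw hxw] := star_strip h4 hn.
have hvw : zig_children v w.
  case: (power_first hw) => [/power_parn [e hc]|[j [d [d' [_ h7 h8]]]]].
    by split=> // i /hc /power_par_inf h9; apply: zig_r h9 (zig_refl _).
  by case: (@reach_red j v v d' d) => // [|i _]; [exact: reach_skel|exact: inf_refl].
have hxw' : zig_children x' w.
  elim: hxw h2 {h1 h3 hn hw hvw} => [a ha|a b c hab _ IH ha].
    by split=> // i _; apply: zig_refl.
  apply: zig_children_trans (IH (rs_inf (par_inf hab) ha)).
  case/par_unfold: hab => [hab|[h1 h2]]; first by case: (ha _ _ (star_refl _ _) hab).
  by split=> // i /h2 /par_inf h7; apply: zig_r h7 (zig_refl _).
have hxy : zig_children x' y'.
  apply: zig_children_trans hxw' _; apply: (@zig_children_trans _ v).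
    by case: hvw => e hc; split=> // i hi; apply/zig_sym/hc; rewrite e.
  split=> // i hi; apply: zig_r (zig_refl _); apply: h6; by rewrite -h5.
by exists y' => //; split=> //; case: hxy => <-.
Qed.

Lemma stable_zig t s t' : zig t s -> stable_reduct t t' ->
  exists2 s', stable_reduct s s' & zig_children t' s'.
Proof.
move=> h; elim: h t' => {t s} [t|t s u h _ IH|t s u h _ IH] t' ht.
- by exists t' => //; split=> // i hi; apply: zig_refl.
- have [v hv hc] := stable_bwd h ht; have [u' hu hc'] := IH _ hv.
  by exists u' => //; apply: zig_children_trans hc hc'.
- have [v hv hc] := stable_fwd h ht; have [u' hu hc'] := IH _ hv.
  by exists u' => //; apply: zig_children_trans hc hc'.
Qed.

Definition nf_step t : lab F V * (nat -> term) :=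
  match excluded_middle_informative (exists t', stable_reduct t t') with
  | left h => let t' := proj1_sig (constructive_indefinite_description _ h) in
              (root t', child t')
  (* [child t] is a dummy, since [LBot] has no arguments. *)
  | right _ => (LBot, child t)
  end.

Definition nf t := unfold ar nf_step t.

(** The invariant has to be conversion: the reduct chosen for [t] and the one found for [s] have
    arguments that are merely convertible. *)
Lemma zig_nf t s : zig t s -> inf s (nf t).
Proof.
move=> h; apply: (@inf_coind (fun s n => exists2 t, zig t s & n = nf t)); last by exists t.
move=> {t h s}s n [t h ->].
case e: (excluded_middle_informative (exists t', stable_reduct t t')) => [h1|h1].
  set t' := proj1_sig (constructive_indefinite_description _ h1).
  have ht : stable_reduct t t'.
    by rewrite /t'; case: constructive_indefinite_description.
  have er : root (nf t) = root t' by rewrite root_unfold /nf_step e.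
  have ec i : i < arty (root t') -> child (nf t) i = nf (child t' i).
    by move=> hi; rewrite child_unfold /nf_step e.
  have [s' [h2 _ _] [h3 h4]] := stable_zig h ht.
  left; exists s'; rewrite er; split=> // i hi; left; exists (child t' i); first exact: h4.
  exact: ec.
have en : nf t = botT V ar by apply: root_bot; rewrite root_unfold /nf_step e.
(* A root-stable reduct of [s] with a root other than [LBot] would transfer to [t], which has
   none. *)
rewrite en; case: (ra_or_rs s) => [hr|[s' h2 h3]]; first by right.
left; exists s'; split=> //; apply: NNPP => h4; apply: (h1).
have [|t' ht _] := stable_zig (zig_sym h) (t' := s'); first by split.
by exists t'.
Qed.

Lemma inf_confluent t s1 s2 : inf t s1 -> inf t s2 -> exists2 w, inf s1 w & inf s2 w.
Proof.
by move=> h1 h2; exists (nf t); apply: zig_nf; [apply: zig_r h1 _|apply: zig_r h2 _];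
  apply: zig_refl.
Qed.

(** * From strong p-convergence to finite reductions *)

Lemma step_at_valid q t s : step_at q t s -> valid t q.
Proof.
elim=> {q t s} [t s _|i q t s hi _ IH]; first exact: valid_nil.
by apply/valid_cons.
Qed.

Lemma step_atP q t s : step_at q t s <->
  valid t q /\ exists2 u, red (at_pos t q) u & s = replace_at t q u.
Proof.
split=> [h|].
  split; first exact: step_at_valid h.
  elim: h => {q t s} [t s h|i q t s hi _ [u h1 h2]]; first by exists s.
  by exists u; rewrite //= -h2.
move=> [v [u]]; elim: q t s v => [|i q IH] t s /= v h ->; first exact: step_root.
by case/valid_cons: v => hi hq; apply: step_child => //; apply: IH.
Qed.

Lemma step_at_label q t s p : step_at q t s -> ~~ prefix q p -> tf s p = tf t p.
Proof.
move=> /step_atP [v [u _ ->]] /negPf h; by rewrite tf_replace_at // /replace h.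
Qed.

Lemma step_at_below q t s p : step_at q t s -> valid t p ->
  (prefix q p -> q = p) -> at_pos s p = at_pos t p \/ st (at_pos t p) (at_pos s p).
Proof.
move=> h; elim: h p => {q t s} [t s h|i q t s hi hst IH] [|j p] hp he.
- by right; apply: red_st.
- by have := he isT.
- by right; exists (i :: q); constructor.
case/valid_cons: hp => hj hp; rewrite /= child_upd //.
case: eqP => [e|_]; last by left.
subst j; apply: IH => // hq; have := he _.
by rewrite prefix_cons eqxx hq => /(_ isT) [].
Qed.

Lemma step_at_red q t s : step_at q t s -> red (at_pos t q) (at_pos s q).
Proof. by elim=> {q t s} //= i q t s hi _ IH; rewrite child_upd // eqxx. Qed.

Section Reduction.
Variables (I : Type) (lt : I -> I -> Prop) (TM TG : I -> term) (ps : I -> position).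
Hypothesis wo : is_wellorder lt.
Hypothesis steps : forall i, step_at (ps i) (TM i) (TG i).
Hypothesis succs : forall i j, is_succ lt i j -> TM j = TG i.
Notation cs := (fun i => tf (ctx (TM i) (ps i))).
Hypothesis lims : forall l, (exists j, lt j l) -> (forall i, ~ is_succ lt i l) ->
  is_liminf ar lt (fun i => lt i l) cs (tf (TM l)).

Notation le i j := (i = j \/ lt i j).

Lemma lt_irr i : ~ lt i i. Proof. by case: wo => h _; apply: h. Qed.
Lemma lt_tr i j k : lt i j -> lt j k -> lt i k.
Proof. by case: wo => _ [h _]; apply: h. Qed.
Lemma lt_tot i j : le i j \/ lt j i.
Proof. by case: wo => _ [_ [/(_ i j) h _]]; tauto. Qed.
Lemma lt_wf : well_founded lt. Proof. by case: wo => _ [_ [_ ]]. Qed.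
Lemma le_lt_tr i j k : le i j -> lt j k -> lt i k.
Proof. by case=> [->|h] //; apply: lt_tr h. Qed.
Lemma le_tr i j k : le i j -> le j k -> le i k.
Proof. by case=> [->|h] // [<-|h']; right=> //; apply: lt_tr h h'. Qed.

Lemma le_sup_in (B : I -> Prop) i j : B i -> B j -> exists2 k, B k & le i k /\ le j k.
Proof.
move=> Bi Bj; case: (lt_tot i j) => h; first by exists j => //; split=> //; left.
by exists i => //; split; [left|right].
Qed.

Lemma wo_min (X : I -> Prop) : (exists i, X i) ->
  exists2 i, X i & forall j, X j -> le i j.
Proof.
move=> [i hi]; apply: NNPP => no; elim/(well_founded_ind lt_wf): i hi => i IH hi.
apply: no; exists i => // j hj; case: (lt_tot i j) => // h.
by case: (IH j h hj).
Qed.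

Lemma succ_exists i j : lt i j -> exists2 k, is_succ lt i k & le k j.
Proof.
move=> h; have [|k hk hm] := @wo_min (lt i); first by exists j.
exists k; last exact: hm.
split=> // l h1 h2; case: (hm l h1) => [e|h3]; first by rewrite e in h2; apply: lt_irr h2.
exact: lt_irr (lt_tr h2 h3).
Qed.

Lemma le_succ g i k : is_succ lt i k -> lt g k -> le g i.
Proof. by move=> [h1 h2] h; case: (lt_tot g i) => // h3; case: (h2 _ h3 h). Qed.

(** [B] is either the set of indices below a limit index or, if the reduction is open, the set of
    all indices, so that inner limits and the final limit are treated alike. *)
Definition limit_of (B : I -> Prop) (t : term) :=
  [/\ is_liminf ar lt B cs (tf t), forall i j, B j -> lt i j -> B i &
      forall i, B i -> exists2 j, B j & is_succ lt i j].

Lemma limit_of_index l : (exists j, lt j l) -> (forall i, ~ is_succ lt i l) ->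
  limit_of (fun i => lt i l) (TM l).
Proof.
move=> h1 h2; split; [exact: lims|by move=> i j h /lt_tr; apply|].
move=> i /succ_exists [k hk [e|h]]; last by exists k.
by rewrite e in hk; case: (h2 i).
Qed.

Lemma label_limit B t : limit_of B t -> forall g p l, B g ->
  (forall k, B k -> le g k -> tf (TM k) p = Some l) ->
  (forall k q, B k -> le g k -> prefix q p -> tf (TM k) q = tf (TM g) q) ->
  (forall k, B k -> le g k -> ~~ prefix (ps k) p) -> tf t p = Some l.
Proof.
move=> [hl _ _] g p l Bg hp hq hk.
have eg : tf (TM g) p = Some l by apply: hp => //; left.
have vg : valid (TM g) p by rewrite /valid eg.
have [vt h1] : valid t p /\ (tf (TM g) p = Some LBot \/ tf t p = tf (TM g) p).
  apply: (liminf_path hl Bg vg) => i Bi gi; exists (ctx (TM i) (ps i)) => // q hqp.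
  rewrite ctx_off; [exact: hq| |exact: step_at_valid (steps i)].
  by apply: contra (hk i Bi gi) => h; apply: prefix_trans h hqp.
(* If [TM g] has [LBot] at [p], any other label of the limit would stand in all late contexts and
   hence in late terms, which have [LBot] there. *)
case: h1 => [e|->] //; rewrite eg in e; case: e => e; subst l.
apply: NNPP => nb; have nb' : root (at_pos t p) <> LBot.
  by move=> e; apply: nb; rewrite (tf_root vt) e.
have [b Bb hb] := liminf_label hl (tf_root vt) nb'.
have [k Bk [gk bk]] := le_sup_in Bg Bb.
have := hb k Bk bk; rewrite ctx_off; [|exact: hk|exact: step_at_valid (steps k)].
by rewrite hp // => -[e]; apply: nb'.
Qed.

Lemma label_stable i : forall g p l, le g i ->
  (forall k, le g k -> lt k i -> ~~ prefix (ps k) p) ->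
  tf (TM g) p = Some l -> tf (TM i) p = Some l.
Proof.
elim/(well_founded_ind lt_wf): i => i IH g p l [<- //|gi] hk hp.
case: (classic (exists j, is_succ lt j i)) => [[j hj]|ns].
  have ji := proj1 hj.
  rewrite (succs hj) (step_at_label (steps j)); last by apply: hk => //; apply: le_succ hj gi.
  by apply: (IH j ji g) (le_succ hj gi) _ hp => k h1 h2; apply: hk => //; apply: lt_tr h2 ji.
have hl : limit_of (fun k => lt k i) (TM i).
  by apply: limit_of_index => [|j hj]; [exists g|apply: ns; exists j].
have key q l' : prefix q p -> tf (TM g) q = Some l' ->
    forall k, lt k i -> le g k -> tf (TM k) q = Some l'.
  move=> hq e k ki gk; apply: (IH k ki g) => // m h1 h2.
  by apply: contra (hk m h1 (lt_tr h2 ki)) => h; apply: prefix_trans h hq.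
apply: (label_limit hl gi) => [|k q ki gk hq|k ki gk]; last exact: hk.
- exact: key (prefix_refl p) hp.
- have vq : valid (TM g) q.
    move=> e; case/prefixP: hq hp => r ->; by rewrite tf_None_cat.
  by rewrite (tf_root vq); apply: (key q _ hq (tf_root vq)).
Qed.

Lemma label_stable_limit B t : limit_of B t -> forall g p l, B g ->
  (forall k, B k -> le g k -> ~~ prefix (ps k) p) ->
  tf (TM g) p = Some l -> tf t p = Some l.
Proof.
move=> hl g p l Bg hk hp; have [_ dn _] := hl.
have key q l' : prefix q p -> tf (TM g) q = Some l' ->
    forall k, B k -> le g k -> tf (TM k) q = Some l'.
  move=> hq e k Bk gk; apply: label_stable gk _ e => m h1 h2.
  by apply: contra (hk m (dn _ _ Bk h2) h1) => h; apply: prefix_trans h hq.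
apply: (label_limit hl Bg) => [|k q ki gk hq|k ki gk]; last exact: hk.
- exact: key (prefix_refl p) hp.
- have vq : valid (TM g) q.
    move=> e; case/prefixP: hq hp => r ->; by rewrite tf_None_cat.
  by rewrite (tf_root vq); apply: (key q _ hq (tf_root vq)).
Qed.

Definition spref (q p : position) := prefix q p && (q != p).

Lemma spref_rcons q p i : prefix q p -> spref q (rcons p i).
Proof.
move=> h; rewrite /spref (prefix_trans h) ?prefix_rcons //=.
by apply/eqP => e; have := size_prefix h; rewrite e size_rcons ltnn.
Qed.

Lemma spref_rconsE q p i : spref q (rcons p i) -> prefix q p.
Proof.
move=> /andP[/prefixP [r]]; case/lastP: r => [|r j].
  by rewrite cats0 => ->; rewrite eqxx.
by rewrite -rcons_cat => /rcons_inj [-> _] _; apply: prefix_prefix.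
Qed.

(** Whether [rcons p j] is valid depends only on validity and label at [p], so contractions at the
    position itself are harmless. *)
Lemma valid_stable g i p : le g i -> (forall k, le g k -> lt k i -> ~~ spref (ps k) p) ->
  valid (TM g) p -> valid (TM i) p.
Proof.
case/lastP: p => [|p j] gi hk; first by move=> _; apply: valid_nil.
move=> /valid_rcons [v hj].
have [|v' e] := valid_label (@label_stable i g p _ gi _ (tf_root v)).
  by move=> k h1 h2; apply: contra (hk k h1 h2); apply: spref_rcons.
by apply/valid_rcons; rewrite e.
Qed.

Lemma valid_stable_limit B t g p : limit_of B t -> B g ->
  (forall k, B k -> le g k -> ~~ spref (ps k) p) -> valid (TM g) p -> valid t p.
Proof.
case/lastP: p => [|p j] hl Bg hk; first by move=> _; apply: valid_nil.
move=> /valid_rcons [v hj].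
have [|v' e] := valid_label (label_stable_limit hl Bg _ (tf_root v)).
  by move=> k h1 h2; apply: contra (hk k h1 h2); apply: spref_rcons.
by apply/valid_rcons; rewrite e.
Qed.

(** Relative to a position and a starting index, because at a limit the coinduction descends to
    arguments that are undisturbed only from some later index on. *)
Definition inf_upto (i : I) := forall g p u, le g i -> valid (TM g) p ->
  (forall k, le g k -> lt k i -> ~~ spref (ps k) p) ->
  inf u (at_pos (TM g) p) -> inf u (at_pos (TM i) p).

(** Below a position contracted cofinally often, the redexes are reached by finite reductions, hence
    [u] is root-active there; at the other positions the root is eventually fixed. *)
Lemma inf_limit B t : limit_of B t -> (forall i, B i -> inf_upto i) ->
  forall g p u, B g -> valid (TM g) p ->
  (forall k, B k -> le g k -> ~~ spref (ps k) p) ->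
  inf u (at_pos (TM g) p) -> inf u (at_pos t p).
Proof.
move=> hl IH g p u Bg vp hk hu; have [hlim dn nx] := hl.
pose X u s := exists g p, [/\ B g, valid (TM g) p,
  forall k, B k -> le g k -> ~~ spref (ps k) p, inf u (at_pos (TM g) p) & s = at_pos t p].
apply: (@inf_coind X); last by exists g, p.
move=> {g p Bg vp hk hu}u _ [g [p [Bg vp hk hu ->]]].
have vt := valid_stable_limit hl Bg hk vp.
have later k : B k -> le g k -> [/\ valid (TM k) p,
    forall m, B m -> le k m -> ~~ spref (ps m) p & inf u (at_pos (TM k) p)].
  move=> Bk gk; have hk' m : le g m -> lt m k -> ~~ spref (ps m) p.
    by move=> h1 h2; apply: hk => //; apply: dn Bk h2.
  split; [exact: valid_stable gk hk' vp| |exact: IH gk vp hk' hu].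
  by move=> m Bm km; apply: hk => //; apply: le_tr gk km.
case: (classic (exists2 k, B k & le g k /\ forall m, B m -> le k m -> ps m <> p)).
  move=> [k Bk [gk hm]]; have [vk hk1 hu1] := later k Bk gk.
  have hpre m : B m -> le k m -> ~~ prefix (ps m) p.
    move=> Bm km; apply: contra (hk1 m Bm km) => h; rewrite /spref h.
    by apply/eqP; apply: hm.
  have [_ er] := valid_label (label_stable_limit hl Bk hpre (tf_root vk)).
  case/inf_unfold: hu1 => [[u' [h1 h2 h3]]|[eb hr]]; last first.
    by right; split=> //; apply: root_bot; rewrite er eb.
  left; exists u'; split=> //; first by rewrite er.
  rewrite er => i hi; left; exists k, (rcons p i); split=> //.
  - by apply/valid_rcons.
  - by move=> m Bm km; apply: contra (hpre m Bm km) => /spref_rconsE.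
  - by rewrite -cats1 at_cat; apply: h3.
  - by rewrite -cats1 at_cat.
move=> cof; right; split.
  (* Another label would stand in all late contexts, but the context of a contraction at [p] has
     [LBot] at [p]. *)
  apply: root_bot; have e := tf_root vt; apply: NNPP => nb.
  have [b Bb hb] := liminf_label hlim e nb.
  apply: cof; have [k Bk [gk bk]] := le_sup_in Bg Bb.
  exists k => //; split=> // m Bm km em.
  have := hb m Bm (le_tr bk km); rewrite ctx_on; last exact: step_at_valid (steps m).
    by rewrite em eqxx => -[e']; case: nb.
  by rewrite em prefix_refl.
apply: (@ra_coind (fun u => exists g, [/\ B g, valid (TM g) p,
  forall k, B k -> le g k -> ~~ spref (ps k) p &
  (inf u (at_pos (TM g) p)) /\ ~ exists2 k, B k &
     le g k /\ forall m, B m -> le k m -> ps m <> p])); last by exists g.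
move=> {u g Bg vp hk hu vt later cof}u [g [Bg vp hk [hu cof]]].
have [k [Bk gk ek]] : exists k, [/\ B k, le g k & ps k = p].
  apply: NNPP => no; apply: cof; exists g => //; split; first by left.
  by move=> m Bm gm em; apply: no; exists m.
have hk' m : le g m -> lt m k -> ~~ spref (ps m) p.
  by move=> h1 h2; apply: hk => //; apply: dn Bk h2.
have huk : inf u (at_pos (TM k) p) by apply: (IH k Bk g).
have hst := step_at_red (steps k); rewrite ek in hst.
have [u' [u'' [h1 h2 h3]]] := inf_red huk hst.
have [k' Bk' hkk'] := nx k Bk.
have gk' : lt g k' by apply: le_lt_tr gk (proj1 hkk').
exists u', u''; split=> //; left; exists k'; split=> //.
- apply: (valid_stable _ _ vp); first by right.
  by move=> m h4 h5; apply: hk => //; apply: dn Bk' h5.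
- by move=> m Bm h4; apply: hk => //; apply: le_tr h4; right.
- rewrite (succs hkk'); split=> // -[m Bm [h4 h5]]; apply: cof; exists m => //.
  by split=> //; apply: le_tr h4; right.
Qed.

Lemma inf_upto_all i : inf_upto i.
Proof.
elim/(well_founded_ind lt_wf): i => i IH g p u [<- //|gi] vp hk hu.
case: (classic (exists j, is_succ lt j i)) => [[j hj]|ns].
  have ji := proj1 hj; have gj := le_succ hj gi.
  have hk' k : le g k -> lt k j -> ~~ spref (ps k) p.
    by move=> h1 h2; apply: hk => //; apply: lt_tr h2 ji.
  have huj := IH j ji g p u gj vp hk' hu.
  have vj := valid_stable gj hk' vp.
  rewrite (succs hj).
  case: (step_at_below (steps j) vj) => [h|->|] //; last exact: inf_step huj.
  have := hk j gj ji; rewrite /spref h /= => /negPn/eqP //.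
have hl : limit_of (fun k => lt k i) (TM i).
  by apply: limit_of_index => [|j hj]; [exists g|apply: ns; exists j].
apply: (inf_limit hl IH gi vp _ hu) => k ki gk; exact: hk.
Qed.

Lemma inf_from_start i : (forall j, ~ lt j i) -> forall k, inf (TM i) (TM k).
Proof.
move=> hmin k; apply: (@inf_upto_all k i [::] (TM i)) => //.
- by case: (lt_tot i k) => // /hmin.
- exact: valid_nil.
- by move=> m _ _; case: (ps m).
- exact: inf_refl.
Qed.

Lemma inf_of_reduction t s :
  (forall i, (forall j, ~ lt j i) -> TM i = t) ->
  ((I -> False) -> t = s) ->
  (forall m, (forall j, ~ lt m j) -> TG m = s) ->
  ((exists i : I, True) -> (forall m, exists j, lt m j) ->
     is_liminf ar lt (fun _ => True) cs (tf s)) ->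
  inf t s.
Proof.
move=> hmin hemp hmax hlim.
case: (classic (exists i : I, True)) => [ex|ne]; last first.
  by rewrite hemp; [apply: inf_refl|move=> i; apply: ne; exists i].
have [i0 _ hi0] := @wo_min (fun _ => True) ex.
have start j : ~ lt j i0 by move=> h; apply: (lt_irr (le_lt_tr (hi0 j Logic.I) h)).
have h0 k := inf_from_start start k.
case: (classic (exists m, forall j, ~ lt m j)) => [[m hm]|nm].
  rewrite -(hmin _ start) -(hmax m hm).
  by apply: (inf_step (h0 m)); exists (ps m).
have unb m : exists j, lt m j.
  by apply: NNPP => h; apply: nm; exists m => j hj; apply: h; exists j.
rewrite -(hmin _ start); apply: (@inf_limit (fun _ => True) s _ _ i0 [::] (TM i0)) => //.
- split=> //; first exact: hlim.
  by move=> i _; have [j /succ_exists [k hk _]] := unb i; exists k.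
- by move=> i _; apply: inf_upto_all.
- exact: valid_nil.
- by move=> m _ _; case: (ps m).
- exact: inf_refl.
Qed.

End Reduction.

(** * Fair reductions of length omega *)

Notation trace := (seq (position * term)).

Fixpoint is_trace (t : term) (l : trace) : Prop :=
  if l is x :: l' then step_at x.1 t x.2 /\ is_trace x.2 l' else True.

Definition endpoint (t : term) (l : trace) : term := last t (map snd l).
Definition redexes (l : trace) : seq position := map fst l.

Lemma is_trace_cat t l l' : is_trace t l -> is_trace (endpoint t l) l' ->
  is_trace t (l ++ l').
Proof. by elim: l t => [|x l IH] t //= [h1 h2] h3; split=> //; apply: IH. Qed.

Lemma endpoint_cat t l l' : endpoint t (l ++ l') = endpoint (endpoint t l) l'.
Proof. by rewrite /endpoint map_cat last_cat. Qed.

Lemma star_trace t s : star st t s -> exists2 l, is_trace t l & endpoint t l = s.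
Proof.
elim=> [a|a b c [q h] _ [l h1 h2]]; first by exists [::].
by exists ((q, b) :: l).
Qed.

Definition lift_trace (i : nat) (t : term) (l : trace) : trace :=
  map (fun x => (i :: x.1, upd t i x.2)) l.

Lemma lift_traceP i t u l : i < arty (root t) -> is_trace u l ->
  is_trace (upd t i u) (lift_trace i t l) /\
  endpoint (upd t i u) (lift_trace i t l) = upd t i (endpoint u l).
Proof.
move=> hi; elim: l u => [|[q v] l IH] u //= [h1 /IH [h2 h3]]; split=> //; split=> //.
rewrite -(upd_upd t i u v); apply: step_child; first by rewrite root_upd.
by rewrite child_upd // eqxx.
Qed.

(** [u] has converged to [s] up to depth [d]; root-active subterms, which have to become [LBot],
    are kept active. *)
Fixpoint converged (d : nat) (u s : term) : Prop :=
  if d is d'.+1 then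
    (root u = root s /\ forall i, i < arty (root s) -> converged d' (child u i) (child s i)) \/
    (s = botT V ar /\ ra u)
  else inf u s.

(** One round of the conditions of [liminf_criterion], where [D] holds the contracted positions:
    final labels are left alone, and a final [LBot] is already present or appears in the context of
    a contraction. *)
Definition progress d (D : position -> Prop) (u s : term) := forall p, size p < d ->
  (forall l, tf s p = Some l -> l <> LBot -> forall q, D q -> ~~ prefix q p) /\
  (tf s p = Some LBot -> tf u p = Some LBot \/ D p).

Lemma trace_children u s d (Q : nat -> term -> Prop) :
  (forall i, i < arty (root u) -> exists l, [/\ is_trace (child u i) l,
     Q i (endpoint (child u i) l) &
     progress d (fun q => q \in redexes l) (child u i) (child s i)]) ->
  exists l, [/\ is_trace u l, root (endpoint u l) = root u,
    forall q, q \in redexes l -> q <> [::] &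
    forall i, i < arty (root u) -> Q i (child (endpoint u l) i) /\
      progress d (fun q => (i :: q) \in redexes l) (child u i) (child s i)].
Proof.
(* The same generalisation as in [star_children]; the bound in the clause on redexes becomes [k] as
   well. *)
move=> h; suff [l [h1 h2 h3 h4]] : exists l, [/\ is_trace u l, root (endpoint u l) = root u,
    forall q, q \in redexes l -> exists2 i, i < arty (root u) & exists q', q = i :: q' &
    forall i, i < arty (root u) ->
      if i < arty (root u) then Q i (child (endpoint u l) i) /\
        progress d (fun q => (i :: q) \in redexes l) (child u i) (child s i)
      else child (endpoint u l) i = child u i].
  exists l; split=> // [q /h3 [i _ [q' ->]] //|i hi]; by have := h4 i hi; rewrite hi.
elim: {1 3}(arty (root u)) => [|k [l [h1 h2 h3 h4]]].
  by exists [::].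
case: (ltnP k (arty (root u))) => hk; last first.
  exists l; split=> // [q /h3 [i hi h5]|i hi]; first by exists i => //; apply: leqW.
  by have := h4 i hi; rewrite (leq_trans hi hk) (leq_trans hi (leqW hk)).
have := h4 k hk; rewrite ltnn => ek.
have [l' [h5 h6 h7]] := h k hk.
have hk' : k < arty (root (endpoint u l)) by rewrite h2.
rewrite -{1}ek in h5.
have [h8 h9] := lift_traceP hk' h5; rewrite upd_id ek in h8 h9.
set m := lift_trace k (endpoint u l) l'.
have em q : q \in redexes m -> exists2 q', q = k :: q' & q' \in redexes l'.
  rewrite /redexes /m /lift_trace -map_comp /=.
  rewrite (map_comp (cons k) fst) => /mapP [q' hq ->]; by exists q'.
have em' q : (k :: q \in redexes m) = (q \in redexes l').
  rewrite /redexes /m /lift_trace -map_comp (map_comp (cons k) fst) mem_map //.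
  by move=> a b [].
exists (l ++ m); split.
- exact: is_trace_cat.
- by rewrite endpoint_cat h9 root_upd.
- move=> q; rewrite /redexes map_cat mem_cat => /orP[/h3 [i hi h10]|/em [q' -> _]].
    by exists i => //; apply: leqW.
  by exists k => //; exists q'.
move=> i hi; rewrite endpoint_cat h9 child_upd ?h2 //; have := h4 i hi.
have -> : (i < k.+1) = (i == k) || (i < k) by rewrite ltnS leq_eqVlt.
case: eqP => [->|ne] /=.
  rewrite ltnn => _; split=> // p hp; have [h10 h11] := h7 p hp; split=> [lb e nb q|e].
    rewrite /redexes map_cat mem_cat => /orP[/h3 [j hj [q' [ej _]]]|].
      by rewrite ej ltnn in hj.
    by rewrite -/(redexes m) em' => hq; apply: h10 e nb q hq.
  case: (h11 e) => h12; [by left|right].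
  by rewrite /redexes map_cat mem_cat -/(redexes m) em' h12 orbT.
case: ifP => // _ [h10 h11]; split=> // p hp; have [h12 h13] := h11 p hp.
split=> [lb e nb q|e].
  rewrite /redexes map_cat mem_cat => /orP[hq|/em [q' [ei _]] //].
  exact: h12 e nb q hq.
case: (h13 e) => h14; [by left|right].
by rewrite /redexes map_cat mem_cat h14.
Qed.

(** At depth 0 [inf] is unfolded once and [progress] is vacuous. At greater depth, a root-active
    subterm already reached receives one more root contraction, so its position carries [LBot] in a
    context again in every round. *)
Lemma converged_progress d u s : converged d u s -> exists l, [/\ is_trace u l,
  converged d.+1 (endpoint u l) s & progress d (fun q => q \in redexes l) u s].
Proof.
elim: d u s => [|d IH] u s /=.
  case/inf_unfold=> [[t' [h1 h2 h3]]|[e h]].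
    by have [l h4 h5] := star_trace h1; exists l; split=> //; left; rewrite h5.
  by exists [::]; split=> //; right.
case=> [[e hc]|[es h]].
  have [i hi|l [h1 h2 h3 h4]] := @trace_children u s d
      (fun i c => converged d.+1 c (child s i)).
    rewrite e in hi; by apply: IH; apply: hc.
  exists l; split=> //.
    left; split; first by rewrite h2.
    by rewrite -e => i /h4 [].
  move=> [|i p] hp.
    rewrite !tf_nil e; split=> [lb _ _ q /h3|->]; last by left.
    by case: q.
  rewrite !tf_cons e; case: ifP => hi; last by [].
  rewrite -e in hi; have [_ /(_ p hp) [h5 h6]] := h4 i hi.
  split=> // lb e1 nb [|j q] hq; first by case: (h3 _ hq).
  rewrite prefix_cons; apply/negP => /andP[/eqP ej hqp]; subst j.
  by move: hqp; apply/negP; apply: h5 e1 nb _ hq.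
case/ra_unfold: h => [u' [u'' [/star_nr_st h1 h2 h3]]].
have [l h4 h5] := star_trace h1.
exists (l ++ [:: ([::], u'')]); split.
- by apply: is_trace_cat => //=; split=> //; rewrite h5; apply: step_root.
- by right; rewrite endpoint_cat.
rewrite es => -[|i p] hp; last by rewrite tf_cons.
split=> [lb [<-] //|_]; right.
by rewrite /redexes map_cat mem_cat inE eqxx orbT.
Qed.

Section Sequence.
Variables (t s : term).
Hypothesis ts : inf t s.

Definition pick_trace d u : trace :=
  match excluded_middle_informative (exists l, [/\ is_trace u l,
     converged d.+1 (endpoint u l) s & progress d (fun q => q \in redexes l) u s]) with
  | left h => proj1_sig (constructive_indefinite_description _ h)
  | right _ => [::]
  end.

Lemma pick_traceP d u : converged d u s -> [/\ is_trace u (pick_trace d u),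
     converged d.+1 (endpoint u (pick_trace d u)) s &
     progress d (fun q => q \in redexes (pick_trace d u)) u s].
Proof.
move=> /converged_progress h; rewrite /pick_trace.
by case: excluded_middle_informative => // h'; case: constructive_indefinite_description.
Qed.

(** Scheduler: in state [(d, u, l)] the current term is [u], and [l] remains to be executed
    in order to reach convergence up to depth [d]. *)
Definition next (x : nat * term * trace) : nat * term * trace :=
  let: (d, u, l) := x in
  if l is y :: l' then (d, y.2, l') else (d.+1, u, pick_trace d u).

Definition sched n := iter n next (0, t, [::]).
Definition cur n : term := (sched n).1.2.
Definition level n : nat := (sched n).1.1.
Definition active n : bool := ~~ nilp (sched n).2.
Definition pos n : position := head [::] (redexes (sched n).2).

(** A trace pending at level [d.+1] was picked at depth [d] and satisfies [progress d]; hence the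
    predecessor of the level. *)
Lemma sched_ok n : [/\ is_trace (cur n) (sched n).2,
  converged (level n) (endpoint (cur n) (sched n).2) s &
  forall p l, size p < (level n).-1 -> tf s p = Some l -> l <> LBot ->
    forall q, q \in redexes (sched n).2 -> ~~ prefix q p].
Proof.
rewrite /cur /level; elim: n => [|n]; first by [].
rewrite [sched n.+1]/=; case: (sched n) => [[d u] [|y l]] /= [h1 h2 h3].
  have [h4 h5 h6] := pick_traceP h2; split=> // p lb hp e nb.
  by have [h7 _] := h6 p hp; apply: h7 e nb.
case: h1 => h1 h1'; split=> // p lb hp e nb q hq.
by apply: (h3 p lb hp e nb q); rewrite inE hq orbT.
Qed.

Lemma active_step n : active n -> step_at (pos n) (cur n) (cur n.+1).
Proof.
have [h _ _] := sched_ok n; rewrite /active /pos /cur [sched n.+1]/=.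
by move: h; rewrite /cur; case: (sched n) => [[d u] [|y l]] //= [].
Qed.

Lemma idle_step n : ~~ active n -> cur n.+1 = cur n.
Proof.
by rewrite /active /cur [sched n.+1]/=; case: (sched n) => [[d u] [|y l]].
Qed.

Lemma pos_mem n : active n -> pos n \in redexes (sched n).2.
Proof. by rewrite /active /pos; case: (sched n).2 => //= y l _; rewrite inE eqxx. Qed.

Lemma level_mono n m : n <= m -> level n <= level m.
Proof.
move=> /subnKC <-; elim: (m - n) => [|k IH]; first by rewrite addn0.
apply: (leq_trans IH); rewrite addnS /level [sched _.+1]/=.
by case: (sched (n + k)) => [[d u] [|y l]].
Qed.

Lemma level_le n : level n <= n.
Proof.
elim: n => // n; rewrite /level [sched n.+1]/=.
by case: (sched n) => [[d u] [|y l]] //= /leqW.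
Qed.

Lemma sched_run n k : k <= size (sched n).2 ->
  sched (n + k) = (level n, endpoint (cur n) (take k (sched n).2), drop k (sched n).2).
Proof.
rewrite /level /cur; elim: k => [|k IH] hk.
  by rewrite addn0 take0 drop0; case: (sched n) => [[]].
rewrite addnS [sched _.+1]/= IH 1?ltnW //= (drop_nth ([::], t) hk).
by rewrite (take_nth ([::], t) hk) /endpoint -cats1 map_cat last_cat.
Qed.

Lemma reach_level d : exists n, [/\ level n = d, (sched n).2 = [::] &
  converged d (cur n) s].
Proof.
elim: d => [|d [n [h1 h2 h3]]]; first by exists 0.
have e : sched n.+1 = (d.+1, cur n, pick_trace d (cur n)).
  rewrite [sched n.+1]/= -h1 /level /cur; move: h2.
  by case: (sched n) => [[d' u] l] /= ->.
move: (n.+1) e => n1 e.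
have := @sched_run n1 _ (leqnn _); rewrite drop_size take_size.
rewrite /level /cur e /= => e'; exists (n1 + size (pick_trace d (cur n))).
rewrite e' /=; split=> //.
by case: (pick_traceP h3).
Qed.

Lemma off_redex d n m p l : level n = d -> (sched n).2 = [::] -> size p < d -> n <= m ->
  active m -> tf s p = Some l -> l <> LBot -> ~~ prefix (pos m) p.
Proof.
move=> h1 h2 hp nm am e nb; have [_ _ /(_ p l)] := sched_ok m.
apply=> //; last exact: pos_mem.
have nm' : n < m.
  rewrite ltn_neqAle nm andbT; apply: contraTneq am => <-; by rewrite /active h2.
have h3 : level n.+1 = d.+1.
  rewrite -h1 /level [sched n.+1]/=; move: h2; by case: (sched n) => [[d' u] l'] /= ->.
by have := level_mono nm'; rewrite h3; case: (level m) => // k; rewrite ltnS; apply: leq_trans.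
Qed.

Lemma label_later n m p l : tf (cur n) p = Some l -> n <= m ->
  (forall k, n <= k < m -> active k -> ~~ prefix (pos k) p) -> tf (cur m) p = Some l.
Proof.
move=> e /subnKC <-; elim: (m - n) => [|k IH] h; first by rewrite addn0.
have {}IH : tf (cur (n + k)) p = Some l.
  apply: IH => j /andP[h1 h2]; apply: h; by rewrite h1 addnS ltnS ltnW.
rewrite addnS; case ha: (active (n + k)); last by rewrite idle_step ?ha.
rewrite (step_at_label (active_step ha)) //; apply: h => //.
by rewrite leq_addr addnS ltnS leqnn.
Qed.

Lemma converged_label d u u' p l : converged d u u' -> size p < d ->
  tf u' p = Some l -> l <> LBot -> tf u p = Some l.
Proof.
elim: d u u' p => // d IH u u' [|i p] /= h hp e nb; move: e.
  rewrite !tf_nil => -[e]; case: h => [[-> _]|[e1 _]]; first by rewrite e.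
  by rewrite e1 in e; case: nb.
rewrite !tf_cons; case: ifP => // hi e; case: h => [[-> h]|[e1 _]].
  by rewrite hi; apply: IH (h i hi) hp e nb.
by rewrite e1 in hi.
Qed.

Lemma sched_label p l : tf s p = Some l -> l <> LBot ->
  exists n, forall m, n <= m -> tf (cur m) p = Some l /\
    (active m -> ~~ prefix (pos m) p).
Proof.
move=> e nb; have [n [h1 h2 h3]] := reach_level (size p).+1.
have h m : n <= m -> active m -> ~~ prefix (pos m) p.
  by move=> nm am; apply: (off_redex h1) e nb.
exists n => m nm; split; last exact: h.
apply: (label_later _ nm) => [|k /andP[nk _]]; last exact: h.
exact: converged_label h3 _ e nb.
Qed.

Lemma sched_bottom p N : tf s p = Some LBot -> exists2 n, N <= n &
  (active n /\ pos n = p) \/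
  forall m, n <= m -> tf (cur m) p = Some LBot /\ (active m -> ~~ prefix (pos m) p).
Proof.
(* A level of at least [N] forces a stage of at least [N] by [level_le]; a level above [size p]
   makes [progress] apply to [p]. *)
move=> e; have [n [h1 h2 h3]] := reach_level (maxn N (size p).+1).
have Nn : N <= n by apply: leq_trans (level_le n); rewrite h1 leq_maxl.
have pn : size p < level n by rewrite h1 leq_maxr.
rewrite -h1 in h3; have [h4 h5 /(_ p pn) [_ /(_ e) h6]] := pick_traceP h3.
have e1 : sched n.+1 = ((level n).+1, cur n, pick_trace (level n) (cur n)).
  rewrite [sched n.+1]/= /level /cur; move: h2.
  by case: (sched n) => [[d' u] l] /= ->.
case: h6 => [h6|]; last first.
  set l := pick_trace _ _ => hpl.
  have hk : index p (redexes l) < size l by rewrite -(size_map fst) index_mem.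
  have e2 : (sched n.+1).2 = l by rewrite e1.
  have := @sched_run n.+1 (index p (redexes l)); rewrite e2 => /(_ (ltnW hk)) e3.
  (* Stage [n] only fetches the trace, which then runs from [n.+1] on; [index] locates the
     contraction at [p] in it. *)
  exists (n.+1 + index p (redexes l)); first by rewrite addSn leqW // (leq_trans Nn) // leq_addr.
  left; rewrite /active /pos e3 /= (drop_nth ([::], t) hk) /=; split=> //.
  by rewrite -(nth_map _ [::]) // nth_index.
exists n => //; right.
(* [LBot] is not a redex, and strictly above [p] the labels of [s] differ from [LBot], so
   [off_redex] excludes contractions there. *)
have off m : n <= m -> tf (cur m) p = Some LBot -> active m -> ~~ prefix (pos m) p.
  move=> nm em am; have hst := active_step am; apply/negP => /prefixP [r]; case/lastP: r => [|r i] ep.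
    rewrite cats0 in ep; subst p; have [v er] := valid_label em.
    by have [f] := red_root (step_at_red hst); rewrite er.
  have [v _] := valid_label e; rewrite ep -rcons_cat in v; have [v1 hi] := proj1 (valid_rcons _ _ _) v.
  have sz : size (pos m ++ r) < level n.
    by apply: leq_trans pn; rewrite ep -rcons_cat size_rcons ltnS leqnSn.
  have := off_redex erefl h2 sz nm am (tf_root v1); rewrite prefix_prefix => h7.
  suff // : false by []; apply: h7 => e7; by rewrite e7 in hi.
have hb m : n <= m -> tf (cur m) p = Some LBot.
  move=> nm; rewrite -(subnKC nm); elim: (m - n) => [|k IH]; first by rewrite addn0.
  rewrite addnS; case ha: (active (n + k)); last by rewrite idle_step ?ha.
  by rewrite (step_at_label (active_step ha)) //; apply: off => //; apply: leq_addr.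
by move=> m nm; split; [apply: hb|apply: off => //; apply: hb].
Qed.

Lemma sched_quiet n : (forall m, n <= m -> ~~ active m) -> cur n = s.
Proof.
move=> h; apply/esym.
have const m : n <= m -> cur m = cur n.
  move=> nm; rewrite -(subnKC nm); elim: (m - n) => [|k IH]; first by rewrite addn0.
  by rewrite addnS idle_step //; apply: h; apply: leq_addr.
apply: (@bisim _ _ _ (fun a b => forall p l, tf a p = Some l -> tf b p = Some l)).
  move=> a b hab; have er : root a = root b.
    by have := hab [::] _ (tf_nil a); rewrite tf_nil => -[->].
  split=> // i hi p l e; have := hab (i :: p) l.
  by rewrite !tf_cons -er hi; apply.
move=> p l e; case: (classic (l = LBot)) => [el|nb].
  rewrite el in e *; have [m nm [[am _]|hm]] := sched_bottom n e.
    by have := h m nm; rewrite am.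
  by rewrite -(const m nm); case: (hm m (leqnn m)).
have [m hm] := sched_label e nb.
rewrite -(const (maxn n m) (leq_maxl _ _)).
by case: (hm (maxn n m) (leq_maxr _ _)).
Qed.

End Sequence.

(** * Equivalence of [inf] and [spconv] *)

Notation lhs := (fun rho => tf (L rho)).
Notation rhs := (fun rho => tf (Rh rho)).

Lemma stepP (a b : term) q : step ar lhs rhs (tf a) q (tf b) <-> step_at q a b.
Proof.
rewrite step_atP; split.
  move=> [_ [v [rho [sg [wsg [e1 e2]]]]]]; split=> //.
  pose sgt x := Term (wsg x); exists (sub (Rh rho) sgt).
    exists rho, sgt; split=> //; apply: term_ext => p; by rewrite tf_at // tf_sub -e1.
  apply: term_ext => p; rewrite tf_replace_at // e2; congr replace.
  by apply: functional_extensionality => r; rewrite tf_sub.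
move=> [v [u [rho [sg [e1 ->]]] ->]]; split; first exact: tf_wf.
split=> //; exists rho, (fun x => tf (sg x)); split; first by move=> x; apply: tf_wf.
split=> [p|p]; first by rewrite -tf_sub -e1 tf_at.
rewrite tf_replace_at //; congr replace.
by apply: functional_extensionality => r; rewrite tf_sub.
Qed.

Lemma inf_of_spconv (t s : term) : spconv ar lhs rhs (tf t) (tf s) -> inf t s.
Proof.
move=> [_ [_ [I [lt [tm [tgt [ps [wo [hst [wtg [hmin [hsucc [hlim [hemp [hmax hend]]]]]]]]]]]]]]].
pose TM i := Term (proj1 (hst i)); pose TG i := Term (wtg i).
have steps i : step_at (ps i) (TM i) (TG i) by apply/stepP; apply: hst.
have cE : (fun i => context (tm i) (ps i)) = (fun i => tf (ctx (TM i) (ps i))).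
  apply: functional_extensionality => i; apply: functional_extensionality => p.
  by rewrite tf_ctx //; apply: step_at_valid (steps i).
rewrite cE in hlim hend.
apply: (@inf_of_reduction I lt TM TG ps wo steps).
- by move=> i j h; apply: term_ext; apply: hsucc.
- exact: hlim.
- by move=> i h; apply: term_ext; apply: hmin.
- by move=> h; apply: term_ext; apply: hemp.
- by move=> m h; apply: term_ext; apply: hmax.
- exact: hend.
Qed.

Lemma spconv_of_inf (t s : term) : inf t s -> spconv ar lhs rhs (tf t) (tf s).
Proof.
move=> ts; split; [exact: tf_wf|split; first exact: tf_wf].
(* Stages that only fetch a trace contract nothing; without them a set of natural numbers remains,
   of order type at most omega. *)
pose I := {n | active t s n}; pose lt (i j : I) := val i < val j.
pose C := cur t s.
have le_val (i j : I) : val i <= val j -> i = j \/ lt i j.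
  by rewrite leq_eqVlt => /orP[/eqP /val_inj|]; [left|right].
have const a b : a <= b -> (forall k, a <= k < b -> ~~ active t s k) -> C b = C a.
  move=> /subnKC <-; elim: (b - a) => [|k IH] h; first by rewrite addn0.
  rewrite addnS /C idle_step; last by apply: h; rewrite leq_addr addnS ltnS leqnn.
  by apply: IH => j /andP[h1 h2]; apply: h; rewrite h1 addnS ltnS ltnW.
(* Settles the empty and the closed reduction: once no active stage is left, the current term is
   [s]. *)
have quiet n : (forall i : I, val i < n) -> C n = s.
  move=> h; apply: sched_quiet => // m nm; apply/negP => am.
  by have := h (exist _ m am); rewrite /= ltnNge nm.
exists I, lt, (fun i => tf (C (val i))), (fun i => tf (C (val i).+1)),
  (fun i => pos t s (val i)).
split.
  split; first by move=> i; rewrite /lt ltnn.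
  split; first by move=> i j k; apply: ltn_trans.
  split; first by move=> i j; case: (ltngtP (val i) (val j)) => h;
    [left|right; right|right; left; apply: val_inj].
  exact: (@wf_measure I val).
have steps (i : I) : step_at (pos t s (val i)) (C (val i)) (C (val i).+1).
  by apply: active_step => //; apply: (valP i).
split; first by move=> i; apply/stepP.
split; first by move=> i; apply: tf_wf.
split.
  move=> i hi p; rewrite (@const 0) // => k /andP[_ ki]; apply/negP => ak.
  exact: (hi (exist _ k ak)).
split.
  move=> i j [ij h] p; rewrite (@const (val i).+1) // => k /andP[ik kj].
  by apply/negP => ak; apply: (h (exist _ k ak)).
split.
  (* There are no limit indices: among the finitely many active stages below [l] the largest is its
     predecessor. *)
  move=> l [j jl] nl; exfalso.
  have ex : exists n, active t s n && (n < val l).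
    by exists (val j); rewrite (valP j).
  have bnd n : active t s n && (n < val l) -> n <= val l by move=> /andP[_ /ltnW].
  case: (ex_maxnP ex bnd) => m /andP[am ml] hm.
  apply: (nl (exist _ m am)); split=> // k mk kl.
  have mk' : m < val k by exact: mk.
  by have := hm (val k); rewrite (valP k) => /(_ kl); rewrite leqNgt mk'.
split.
  by move=> ne p; rewrite -(quiet 0) // => i; case: (ne i).
split.
  move=> m hm p; rewrite quiet // => i; rewrite ltnS leqNgt; apply/negP; exact: hm.
move=> [i0 _] unb.
have large n : exists i : I, n <= val i.
  elim: n => [|n [i hi]]; first by exists i0.
  by have [j hj] := unb i; exists j; apply: leq_ltn_trans hi hj.
have -> : (fun i : I => context (tf (C (val i))) (pos t s (val i))) =
          (fun i => tf (ctx (C (val i)) (pos t s (val i)))).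
  apply: functional_extensionality => i; apply: functional_extensionality => p.
  by rewrite tf_ctx //; apply: step_at_valid (steps i).
have le_leq (i j : I) : i = j \/ lt i j -> val i <= val j by case=> [->|/ltnW].
apply: (@liminf_criterion _ _ _ I lt (fun i => ctx (C (val i)) (pos t s (val i)))).
- by move=> i j; case: (leqP (val i) (val j)) => [/le_val|/ltnW /le_val]; [left|right].
- by move=> i j k /le_leq ij /le_leq jk; apply/le_val/leq_trans/jk.
- move=> p l e nb; have [n hn] := sched_label ts e nb; have [b nb'] := large n.
  exists b => i /le_leq bi; have [h1 h2] := hn (val i) (leq_trans nb' bi).
  rewrite ctx_off //; first by apply: h2; apply: valP i.
  exact: step_at_valid (steps i).
- move=> p e b; have [n bn [[an pn]|hn]] := sched_bottom ts (val b) e.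
    exists (exist _ n an); first exact: le_val.
    rewrite ctx_on /= ?pn ?prefix_refl ?eqxx //.
    by rewrite -pn; apply: step_at_valid (steps (exist _ n an)).
  have [i ni] := large n; exists i; first by apply: le_val; apply: leq_trans ni.
  have [h1 h2] := hn (val i) ni.
  rewrite ctx_off //; first by apply: h2; apply: valP i.
  exact: step_at_valid (steps i).
Qed.

Lemma spconv_confluent (t s1 s2 : term) :
  spconv ar lhs rhs (tf t) (tf s1) -> spconv ar lhs rhs (tf t) (tf s2) ->
  exists t' : term,
    spconv ar lhs rhs (tf s1) (tf t') /\ spconv ar lhs rhs (tf s2) (tf t').
Proof.
move=> /inf_of_spconv h1 /inf_of_spconv h2.
have [w hw1 hw2] := inf_confluent h1 h2.
by exists w; split; apply: spconv_of_inf.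
Qed.

End Rewriting.

(** * From total to partial substitutions in non-overlap *)

Section Fill.
Variables (F V : Type) (ar : F -> nat) (v : V).
Notation term := (term V ar).

(** Non-overlapping is stated for total substitutions, whereas terms in a reduction are partial; the
    two agree because instances remain equal when every [LBot] is replaced by a fixed variable. *)
Definition fill_fun (t : term) : pterm F V := fun p =>
  if tf t p is Some LBot then Some (LVar v) else tf t p.

Lemma wf_fill t : wf_term ar (fill_fun t).
Proof.
have e p : fill_fun t p <> None <-> tf t p <> None.
  by rewrite /fill_fun; case: (tf t p) => // -[].
case: (tf_wf t) => h1 [h2 h3]; split; first by apply/e.
split=> [p i h|p l i].
  by apply: NNPP => /e; apply; apply: h2; apply: NNPP => /e.
rewrite e /fill_fun; case ep: (tf t p) => [[f|x|]|] // [<-]; exact: (h3 p _ i ep).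
Qed.

Definition fill t := Term (wf_fill t).

Lemma total_fill t : Defs.total (tf (fill t)).
Proof. by move=> p /=; rewrite /fill_fun; case: (tf t p) => [[]|]. Qed.

Lemma sub_fill p sg : tot p -> sub p (fun x => fill (sg x)) = fill (sub p sg).
Proof.
move=> hp; apply: term_ext => q; rewrite [RHS]/= /fill_fun.
elim: q p hp => [|i q IH] p hp.
  rewrite !tf_nil; case e: (root p) => [f|x|].
  - have nv x : root p <> LVar x by rewrite e.
    by rewrite !root_sub // e.
  - by rewrite !(sub_var _ e) -tf_nil /= /fill_fun !tf_nil.
  - by case: (hp [::]); rewrite tf_nil e.
case: (classic (isvar p)) => [[x e]|/not_isvar nv]; first by rewrite !(sub_var _ e).
rewrite !tf_cons !root_sub //; case: ifP => // hi.
by rewrite !child_sub // IH //; apply: tot_child.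
Qed.
End Fill.

Lemma nonoverlapping_instances (F V R : Type) (ar : F -> nat) (L : R -> term V ar)
  (L_tot : forall rho, tot (L rho)) (no : non_overlapping ar (fun rho => tf (L rho)))
  rho rho' q f (p : term V ar) sg sg' :
  tf (L rho) q = Some (LFun f) -> (forall r, tf p r = tf (L rho) (q ++ r)) ->
  sub p sg = sub (L rho') sg' -> rho = rho' /\ q = [::].
Proof.
move=> e hp es; have := no rho rho' q f e; apply.
have -> : subterm (tf (L rho)) q = tf p.
  by apply: functional_extensionality => r; rewrite hp.
have tp : tot p by move=> r; rewrite hp; apply: L_tot.
(* Filling needs some variable; if [V] is empty, the conditions on the substitutions hold vacuously
   and the given ones serve. *)
case: (classic (exists v : V, True)) => [[v _]|nv].
  exists (fun x => tf (fill v (sg x))), (fun x => tf (fill v (sg' x))).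
  split=> [x|]; first by split; [apply: tf_wf|apply: total_fill].
  split=> [x|r]; first by split; [apply: tf_wf|apply: total_fill].
  by rewrite -!(tf_sub _ (fun x => fill v _)) !sub_fill // es.
exists (fun x => tf (sg x)), (fun x => tf (sg' x)).
split=> [x|]; first by case: nv; exists x.
split=> [x|r]; first by case: nv; exists x.
by rewrite -!tf_sub es.
Qed.

Lemma finite_pattern (F V : Type) (ar : F -> nat) (t : term V ar) (l : seq position) :
  (forall p, tf t p <> None -> p \in l) -> fin t.
Proof.
move=> h; have {h} [n] : exists n, forall p, tf t p <> None -> size p < n.
  exists (\max_(p <- l) size p).+1 => p /h hp.
  by rewrite ltnS; apply: (@leq_bigmax_seq _ l xpredT (fun p => size p)).
elim: n t => [|n IH] t h; first by have := h [::] (@valid_nil _ _ _ t).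
constructor=> i hi; apply: IH => p hp; apply: (h (i :: p)).
by apply/valid_cons.
Qed.

Theorem theorem6p13 (F V R : Type) (ar : F -> nat) (lhs rhs : R -> pterm F V)
  (Htrs : is_trs ar lhs rhs) (Horth : orthogonal ar lhs)
  (Hlf : left_finite lhs) (t s1 s2 : pterm F V) :
  spconv ar lhs rhs t s1 -> spconv ar lhs rhs t s2 ->
  exists t' : pterm F V, spconv ar lhs rhs s1 t' /\ spconv ar lhs rhs s2 t'.
Proof.
move=> h1 h2; have [wt [ws1 _]] := h1; have [_ [ws2 _]] := h2.
pose L rho := Term (proj1 (Htrs rho)).
pose Rh rho := Term (proj1 (proj2 (Htrs rho))).
have [||||||w hw] := @spconv_confluent F V R ar L Rh _ _ _ _ _ _
  (Term wt) (Term ws1) (Term ws2) h1 h2.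
- by move=> rho; case: (Htrs rho) => _ [_ []].
- by move=> rho; have [l hl] := Hlf rho; apply: (@finite_pattern _ _ _ (L rho) l).
- by move=> rho p q x; apply: (proj1 Horth rho).
- move=> rho x e; have [_ [_ [_ [_ [h _]]]]] := Htrs rho.
  by apply: (h x); have := tf_nil (L rho); rewrite e.
- move=> rho x [q hq]; have [_ [_ [_ [_ [_ h]]]]] := Htrs rho; exact: h hq.
- move=> rho rho' q f p sg sg'; apply: nonoverlapping_instances.
    by move=> r; case: (Htrs r) => _ [_ []].
  exact: (proj2 Horth).
by exists (tf w).
Qed.
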